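(* Let $\psi$ and $\lambda>0$ be as in the context, and for each $N\ge 1$ let $\sigma_N$ be the first hitting time of the empty set $\emptyset$ by the reversible nearest particle system on $\{1,2,\dots,N\}$ with parameters $\psi,\lambda$, started from the full configuration $\{1,2,\dots,N\}$. Let $\{C_N: N\ge 1\}$ be any increasing sequence of numbers with $\lim_{N\to\infty} C_N=\infty$. (1) If $$\lambda<\min\left\{1,\ \inf_{n\ge 2}\frac{\psi(n)}{\sum_{l+r=n}\psi(l)\psi(r)}\right\},$$ where the inner sum is over integers $l,r\ge 1$ with $l+r=n$, then there is a constant $C$, independent of $N$, such that $E\sigma_N\le C\log N$ for all $N\ge 2$, and $$\lim_{N\to\infty}P(\sigma_N\le C_N\log N)=1.$$ (2) If $\lambda>1$, then there is a constant $\gamma>0$ such that $$\lim_{N\to\infty}P\left(\sigma_N\ge e^{\gamma N}\right)=1.$$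
   Context: Let $\psi:\{1,2,3,\dots\}\to(0,\infty)$ satisfy $\sum_{n=1}^\infty\psi(n)=1$, the ratio $\psi(n)/\psi(n+1)$ is decreasing (non-increasing) in $n$ with limit $1$ as $n\to\infty$, and $\sum_n n^2\psi(n)<\infty$. Let $\lambda>0$. Define $\beta(l,r)=\lambda\,\psi(l)\psi(r)/\psi(l+r)$ for integers $l,r\ge 1$, $\beta(l,\infty)=\beta(\infty,l)=\lambda\psi(l)$ for integers $l\ge1$, and $\beta(\infty,\infty)=0$. For $A\subset\{1,\dots,N\}$ and $x\in\{1,\dots,N\}\setminus A$, let $l_x(A)$ and $r_x(A)$ be the distances from $x$ to the nearest point of $A$ to the left and to the right of $x$, respectively, with the value $\infty$ if there is no such point. The reversible nearest particle system on $\{1,\dots,N\}$ with parameters $\psi,\lambda$ is the continuous time Markov chain whose state space is the set of all subsets of $\{1,\dots,N\}$, with jump rates $q(A,A\setminus\{x\})=1$ if $x\in A$; $q(A,A\cup\{x\})=\beta(l_x(A),r_x(A))$ if $x\in\{1,\dots,N\}\setminus A$; and $q(A,B)=0$ for all other $B\ne A$. In particular $\emptyset$ is absorbing. *)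

(* Defs.v *)
From HB Require Import structures.
From mathcomp Require Import all_boot all_order all_algebra.
From mathcomp Require Import all_classical all_reals all_analysis.

Set Implicit Arguments.
Unset Strict Implicit.
Unset Printing Implicit Defensive.
Import Order.TTheory GRing.Theory Num.Theory.
Import numFieldNormedType.Exports.
Local Open Scope classical_set_scope.
Local Open Scope ring_scope.

(** * Continuous-time Markov chains on a finite state space *)

Section MarkovChain.
Context {R : realType} {S : finType}.

(* Only the off-diagonal values of the jump rates [q] matter. *)
Definition generator (q : S -> S -> R) (i j : S) : R :=
  if i == j then - \sum_(k | k != i) q i k else q i j.

(* The last field says that [p] is differentiable from the right at time 0,
   with Q-matrix [generator q]. On a finite state space these properties
   characterise the matrices [p t = exp (t Q)]. *)
Record is_transition_function (q : S -> S -> R) (p : R -> S -> S -> R) : Prop :=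
  { trf0 : forall i j, p 0 i j = (i == j)%:R;
    trf_ge0 : forall t i j, 0 <= t -> 0 <= p t i j;
    trf_sum1 : forall t i, 0 <= t -> \sum_j p t i j = 1;
    trf_semigroup : forall s t i j, 0 <= s -> 0 <= t ->
      p (s + t) i j = \sum_k p s i k * p t k j;
    trf_rate : forall i j,
      (p h i j - (i == j)%:R) / h @[h --> 0^'+] --> generator q i j }.

(* [p (t1 - t) i i1 * p (t2 - t1) i1 i2 * ...] for
   [s = [:: (t1, i1); (t2, i2); ...]], the chain being in [i] at time [t]. *)
Fixpoint path_prob (p : R -> S -> S -> R) (t : R) (i : S) (s : seq (R * S)) : R :=
  if s is (u, j) :: s' then p (u - t) i j * path_prob p u j s' else 1.

(* [X t w] is only relevant for [0 <= t]. *)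
Record is_markov_chain {d : measure_display} {Omega : measurableType d}
    (P : probability Omega R) (q : S -> S -> R) (i0 : S)
    (X : R -> Omega -> S) : Prop :=
  { mc_measurable : forall t i, 0 <= t -> measurable [set w | X t w = i];
    mc_right_continuous : forall w t, 0 <= t ->
      \forall s \near t^'+, X s w = X t w;
    mc_fdd : exists2 p, is_transition_function q p &
      forall s : seq (R * S), path <=%R 0 (unzip1 s) ->
        P [set w | forall t i, (t, i) \in s -> X t w = i]
          = (path_prob p 0 i0 s)%:E }.

Definition hitting_time {Omega : Type} (X : R -> Omega -> S) (i : S) (w : Omega) :
    \bar R :=
  ereal_inf [set t%:E | t in [set t : R | 0 <= t /\ X t w = i]].

End MarkovChain.

(** * Reversible nearest particle systems *)

Section NearestParticleSystem.
Context {R : realType}.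

(* The value [psi 0] is irrelevant throughout. *)
Record nps_weight (psi : nat -> R) : Prop :=
  { nps_gt0 : forall n, (1 <= n)%N -> 0 < psi n;
    nps_sum1 : (\sum_(1 <= n <oo) (psi n)%:E = 1)%E;
    nps_ratio_noninc : forall m n, (1 <= m)%N -> (m <= n)%N ->
      psi n / psi n.+1 <= psi m / psi m.+1;
    nps_ratio_cvg : psi n / psi n.+1 @[n --> \oo] --> (1 : R);
    nps_moment2 : (\sum_(1 <= n <oo) (n%:R ^+ 2 * psi n)%:E < +oo)%E }.

(* [None] encodes the distance infinity. *)
Definition beta (psi : nat -> R) (lambda : R) (l r : option nat) : R :=
  match l, r with
  | Some l, Some r => lambda * (psi l * psi r / psi (l + r)%N)
  | Some l, None => lambda * psi l
  | None, Some r => lambda * psi r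
  | None, None => 0
  end.

(* Sites 1, ..., N are represented by 0, ..., N - 1. The default value [N] of
   the minima exceeds every distance. *)
Definition ldist {N : nat} (A : {set 'I_N}) (x : 'I_N) : option nat :=
  if [exists y in A, (y < x)%N]
  then Some (\big[minn/N]_(y in A | (y < x)%N) (x - y)%N) else None.

Definition rdist {N : nat} (A : {set 'I_N}) (x : 'I_N) : option nat :=
  if [exists y in A, (x < y)%N]
  then Some (\big[minn/N]_(y in A | (x < y)%N) (y - x)%N) else None.

(* At most one term of the two sums is present, since [A] and [B] determine
   the site that is flipped. *)
Definition nps_rate (psi : nat -> R) (lambda : R) {N : nat} (A B : {set 'I_N}) : R :=
  \sum_(x in A | B == (A :\ x)%SET) 1 +
  \sum_(x | (x \notin A) && (B == (x |: A)%SET))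
     beta psi lambda (ldist A x) (rdist A x).

Definition is_nps_from_full (psi : nat -> R) (lambda : R) {N : nat}
    {d : measure_display} {Omega : measurableType d} (P : probability Omega R)
    (X : R -> Omega -> {set 'I_N}) : Prop :=
  is_markov_chain P (nps_rate psi lambda) [set: 'I_N]%SET X.

Definition extinction_time {N : nat} {Omega : Type}
    (X : R -> Omega -> {set 'I_N}) : Omega -> \bar R :=
  hitting_time X finset.set0.

Definition subcritical_bound (psi : nat -> R) : R :=
  inf [set psi n / \sum_(1 <= l < n) psi l * psi (n - l)%N
      | n in [set n : nat | (2 <= n)%N]].

End NearestParticleSystem.

(* Main.v *)
(* On a finite state space the transition semigroup is the limit of the Euler
   schemes (1 + (t / n) Q)^n, so order properties of Q pass to it.

   Subcritical case: summing birth rates gap by gap bounds the total birth rate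
   of A by mu (|A| + 1) with mu < 1. Since each particle dies at rate 1, a
   slightly concave-corrected function of |A| is contracted by Q at a fixed
   exponential rate, whence P(X_t <> set0) <= C N e^(- c t).

   Supercritical case: the weights nu(A) = lambda^|A| prod psi(gaps) are
   reversible off set0, so the nu-mass that has leaked into set0 by time t is at
   most lambda N t. The system is attractive because psi n / psi (n + 1)
   decreases, so extinction from the full configuration is the least likely,
   and P(X_t = set0) <= lambda N t / nu(nonempty sets). A renewal inequality on
   the leftmost particle makes the denominator exponentially large in N. *)

Require Import Defs.
From HB Require Import structures.
From mathcomp Require Import all_boot all_order all_algebra.
From mathcomp Require Import all_classical all_reals all_analysis.
From mathcomp Require Import measurable_realfun.
From mathcomp Require Import ring lra zify.
Import Order.TTheory GRing.Theory Num.Theory.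
Import numFieldNormedType.Exports.
Local Open Scope classical_set_scope.
Local Open Scope ring_scope.

(** * Euler approximation of the semigroup *)

Section EulerScheme.
Context {R : realType} {S : finType}.
Implicit Types (q : S -> S -> R) (p : R -> S -> S -> R) (f g : S -> R).

(** The generator applied to [f]; the differences make the diagonal of [q] drop out. *)
Definition drift q f (i : S) : R := \sum_j q i j * (f j - f i).

Definition euler q (h : R) f (i : S) : R := f i + h * drift q f i.

Lemma drift_generator q f i : drift q f i = \sum_j generator q i j * f j.
Proof.
rewrite /drift (bigD1 i)//= subrr mulr0 add0r [RHS](bigD1 i)//= /generator eqxx.
rewrite mulNr addrC mulr_suml -sumrB; apply: eq_bigr => j ji.
by rewrite eq_sym (negbTE ji) mulrBr.
Qed.

(** A sum over all states, which dominates every exit rate; it only serves to say when a time step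
    is small. *)
Definition max_exit_rate q : R := \sum_i \sum_j q i j.

Lemma exit_rate_le q i : (forall i j, 0 <= q i j) ->
  \sum_j q i j <= max_exit_rate q.
Proof.
move=> q0; rewrite /max_exit_rate [leRHS](bigD1 i)//= lerDl.
by apply: sumr_ge0 => k _; apply: sumr_ge0.
Qed.

(** For such a step [h] the matrix [1 + h Q] has nonnegative entries: the difference of the two
    sides is a nonnegative combination of the values [g j - f j]. *)
Lemma le_euler q h f g : (forall i j, 0 <= q i j) ->
  0 <= h -> h * max_exit_rate q <= 1 ->
  (forall i, f i <= g i) -> forall i, euler q h f i <= euler q h g i.
Proof.
move=> q0 h0 hq fg i; rewrite -subr_ge0.
have -> : euler q h g i - euler q h f i =
   (g i - f i) * (1 - h * \sum_j q i j) + h * \sum_j q i j * (g j - f j).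
  rewrite /euler /drift.
  under eq_bigr do rewrite mulrBr.
  under [X in _ - (_ + _ * X)]eq_bigr do rewrite mulrBr.
  under [X in _ = _ + _ * X]eq_bigr do rewrite mulrBr.
  rewrite !sumrB -!mulr_suml; ring.
apply: addr_ge0; apply: mulr_ge0 => //.
- by rewrite subr_ge0.
- rewrite subr_ge0 (le_trans _ hq)// ler_wpM2l//; exact: exit_rate_le.
- by apply: sumr_ge0 => j _; rewrite mulr_ge0// subr_ge0.
Qed.

Lemma euler_cst q h (c : R) i : euler q h (fun=> c) i = c.
Proof. by rewrite /euler /drift big1 ?mulr0 ?addr0// => j _; rewrite subrr mulr0. Qed.

Lemma iter_euler_norm q h f (M : R) n : (forall i j, 0 <= q i j) ->
  0 <= h -> h * max_exit_rate q <= 1 ->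
  (forall i, `|f i| <= M) -> forall i, `|iter n (euler q h) f i| <= M.
Proof.
move=> q0 h0 hq fM; elim: n => //= n IH i; rewrite ler_norml; apply/andP; split.
- rewrite -(euler_cst q h (- M) i); apply: le_euler => // j.
  by have := IH j; rewrite ler_norml => /andP[].
- rewrite -[leRHS](euler_cst q h M i); apply: le_euler => // j.
  by have := IH j; rewrite ler_norml => /andP[].
Qed.

(** * Transition functions as limits of Euler schemes *)

Definition expect p (t : R) f (i : S) : R := \sum_j p t i j * f j.

Section TransitionFunction.
Context (q : S -> S -> R) (p : R -> S -> S -> R).
Hypotheses (q_ge0 : forall i j, 0 <= q i j) (hp : is_transition_function q p).

Lemma expect0 f i : expect p 0 f i = f i.
Proof.
rewrite /expect (bigD1 i)//= (trf0 hp) eqxx mul1r big1 ?addr0// => j ji.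
by rewrite (trf0 hp) eq_sym (negbTE ji) mul0r.
Qed.

Lemma expectD s t f i : 0 <= s -> 0 <= t ->
  expect p (s + t) f i = expect p s (expect p t f) i.
Proof.
move=> s0 t0; rewrite /expect.
under eq_bigr do rewrite (trf_semigroup hp)// mulr_suml.
rewrite exchange_big/=; apply: eq_bigr => k _; rewrite mulr_sumr.
by apply: eq_bigr => j _; rewrite mulrA.
Qed.

Lemma expect_iter h f n i : 0 <= h ->
  expect p (n%:R * h) f i = iter n (expect p h) f i.
Proof.
move=> h0; elim: n i => [|n IH] i; first by rewrite mul0r expect0.
rewrite -nat1r mulrDl mul1r expectD ?mulr_ge0//=.
by congr (expect _ _ _ _); apply/funext => j; rewrite IH.
Qed.

Lemma expect_norm t f (M : R) i : 0 <= t -> (forall j, `|f j| <= M) ->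
  `|expect p t f i| <= M.
Proof.
move=> t0 fM; rewrite -[leRHS]mul1r -(trf_sum1 hp i t0) mulr_suml.
apply: (le_trans (ler_norm_sum _ _ _)); apply: ler_sum => j _.
by rewrite normrM (ger0_norm (trf_ge0 hp _ _ t0)) ler_wpM2l ?(trf_ge0 hp).
Qed.

Lemma expectB t f g i : expect p t (fun j => f j - g j) i =
  expect p t f i - expect p t g i.
Proof. by rewrite /expect -sumrB; apply: eq_bigr => j _; rewrite mulrBr. Qed.

(** There are finitely many pairs of states, so differentiability at time 0 is uniform over them,
    and the error is linear in the sup norm of [f]. *)
Lemma euler_local_error (e : R) : 0 < e ->
  \forall h \near 0^'+, forall f M, (forall j, `|f j| <= M) ->
    forall i, `|expect p h f i - euler q h f i| <= h * (e * M).
Proof.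
move=> e0.
(* An error of [e / K] in each entry adds up to at most [e] over a row. *)
pose K : R := #|S|%:R + 1.
have K0 : 0 < K by rewrite ltr_wpDl.
have eK : 0 < e / K by rewrite divr_gt0.
have H : \forall h \near 0^'+, forall ij : S * S,
    `|generator q ij.1 ij.2 - (p h ij.1 ij.2 - (ij.1 == ij.2)%:R) / h| < e / K.
  apply: filter_forall => -[i j] /=.
  by have /cvgrPdist_lt := @trf_rate _ _ _ _ hp i j; apply.
near=> h => f M fM i.
have h0 : 0 < h by near: h; exact: nbhs_right_gt.
have Hh : forall ij : S * S,
    `|generator q ij.1 ij.2 - (p h ij.1 ij.2 - (ij.1 == ij.2)%:R) / h| < e / K.
  by near: h.
have M0 : 0 <= M by rewrite (le_trans (normr_ge0 _) (fM i)).
have -> : expect p h f i - euler q h f i =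
    h * \sum_j ((p h i j - (i == j)%:R) / h - generator q i j) * f j.
  under eq_bigr do rewrite mulrBl.
  rewrite sumrB -drift_generator mulrBr mulr_sumr /euler opprD addrA; congr (_ - _).
  under [RHS]eq_bigr do rewrite mulrA [h * _]mulrC divfK ?gt_eqF// mulrBl.
  rewrite sumrB; congr (_ - _).
  rewrite (bigD1 i)//= eqxx mul1r big1 ?addr0// => j ji.
  by rewrite eq_sym (negbTE ji) mul0r.
rewrite normrM (gtr0_norm h0) ler_pM2l//.
apply: (le_trans (ler_norm_sum _ _ _)).
apply: (@le_trans _ _ (\sum_(j : S) (e / K * M))).
  apply: ler_sum => j _; rewrite normrM ler_pM//.
  rewrite distrC ltW//; exact: (Hh (i, j)).
rewrite sumr_const -mulr_natr mulrAC ler_wpM2r//.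
rewrite -mulrA [_^-1 * _]mulrC mulrA ler_pdivrMr// ler_wpM2l ?(ltW e0)//.
by rewrite lerDl.
Unshelve. all: by end_near.
Qed.

(** Both one-step operators are contractions for the sup norm, so the [n] local errors simply add
    up. *)
Lemma euler_global_error (e : R) : 0 < e ->
  \forall h \near 0^'+, forall n f M, (forall j, `|f j| <= M) ->
    forall i, `|iter n (expect p h) f i - iter n (euler q h) f i|
      <= n%:R * (h * (e * M)).
Proof.
move=> e0.
have Q0 : 0 <= max_exit_rate q by apply: sumr_ge0 => i _; apply: sumr_ge0.
have Q1 : 0 < max_exit_rate q + 1 by rewrite ltr_wpDl.
near=> h.
have h0 : 0 < h by near: h; exact: nbhs_right_gt.
have hq : h * max_exit_rate q <= 1.
  rewrite (@le_trans _ _ (h * (max_exit_rate q + 1)))//.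
    by rewrite ler_pM2l// lerDl.
  rewrite -ler_pdivlMr// div1r.
  by near: h; apply: nbhs_right_le; rewrite invr_gt0.
have loc : forall f M, (forall j, `|f j| <= M) ->
    forall i, `|expect p h f i - euler q h f i| <= h * (e * M).
  by near: h; exact: euler_local_error.
move=> n f M fM; elim: n => [|n IH] i /=; first by rewrite subrr normr0 mul0r.
have -> : expect p h (iter n (expect p h) f) i - euler q h (iter n (euler q h) f) i
  = expect p h (fun j => iter n (expect p h) f j - iter n (euler q h) f j) i
    + (expect p h (iter n (euler q h) f) i - euler q h (iter n (euler q h) f) i).
  by rewrite expectB addrA subrK.
apply: (le_trans (ler_normD _ _)).
rewrite -addn1 natrD mulrDl mul1r lerD//.
  by apply: expect_norm => //; exact: ltW.
by apply: loc; apply: iter_euler_norm => //; exact: ltW.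
Unshelve. all: by end_near.
Qed.

Lemma euler_step_near (P : R -> Prop) (t : R) : 0 < t ->
  (\forall h \near 0^'+, P h) -> \forall n \near \oo, P (t / n%:R).
Proof.
move=> t0 [e /= e0 He].
near=> n.
have n0 : (0 < n)%N by near: n; exact: nbhs_infty_gt.
have tn0 : 0 < t / n%:R by rewrite divr_gt0// ltr0n.
apply: He => //=.
rewrite sub0r normrN gtr0_norm// ltr_pdivrMr ?ltr0n// mulrC -ltr_pdivrMr//.
near: n; exact: nbhs_infty_gtr.
Unshelve. all: by end_near.
Qed.

Lemma euler_cvg (t : R) f i : 0 <= t ->
  iter n (euler q (t / n%:R)) f i @[n --> \oo] --> expect p t f i.
Proof.
rewrite le_eqVlt => /orP[/eqP <-|t0].
  have -> : (fun n => iter n (euler q (0 / n%:R)) f i) = (fun=> f i).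
    apply/funext => n; rewrite mul0r; elim: n i => //= n IH i.
    by rewrite /euler mul0r addr0 IH.
  by rewrite expect0; exact: cvg_cst.
pose M := \sum_j `|f j| + 1.
have fM j : `|f j| <= M.
  rewrite /M (bigD1 j)//= -addrA lerDl addr_ge0// sumr_ge0//.
have M0 : 0 < M by rewrite ltr_wpDl// sumr_ge0.
apply/cvgrPdist_le => e e0.
(* With this precision the [n] steps of length [t / n] accumulate an error of exactly [e]. *)
have /(euler_step_near _ _ t0) H := @euler_global_error (e / (t * M))
  (divr_gt0 e0 (mulr_gt0 t0 M0)).
near=> n.
have n0 : (0 < n)%N by near: n; exact: nbhs_infty_gt.
have nt : n%:R * (t / n%:R) = t by rewrite mulrC divfK// pnatr_eq0 -lt0n.
have Hn : forall m f M', (forall j, `|f j| <= M') -> forall i,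
    `|iter m (expect p (t / n%:R)) f i - iter m (euler q (t / n%:R)) f i|
      <= m%:R * (t / n%:R * (e / (t * M) * M')).
  by near: n.
have := Hn n f M fM i.
rewrite -expect_iter ?nt; last by rewrite divr_ge0// ltW.
move=> /le_trans; apply.
rewrite mulrA nt (_ : t * _ = e)//.
by field; rewrite !gt_eqF.
Unshelve. all: by end_near.
Qed.

Lemma euler_step_small (t c : R) : 0 <= t -> \forall n \near \oo, t / n%:R * c <= 1.
Proof.
rewrite le_eqVlt => /orP[/eqP <-|t0]; first by near=> n; rewrite !mul0r.
near=> n.
have n0 : 0 < n%:R :> R by rewrite ltr0n; near: n; exact: nbhs_infty_gt.
rewrite mulrAC ler_pdivrMr// mul1r.
near: n; exact: nbhs_infty_ger.
Unshelve. all: by end_near.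
Qed.

(** One Euler step multiplies [f] by at most [1 - h * c]. Monotonicity of the step iterates this,
    and [1 - h * c <= expR (- (h * c))]. *)
Lemma expect_decay (c t : R) f : 0 <= t -> 0 <= c -> (forall i, 0 <= f i) ->
  (forall i, drift q f i <= - c * f i) ->
  forall i, expect p t f i <= expR (- (c * t)) * f i.
Proof.
move=> t0 c0 f0 df i; apply: (cvgr_to_le (@euler_cvg t f i t0)).
near=> n.
have n0 : (0 < n)%N by near: n; exact: nbhs_infty_gt.
have hq : t / n%:R * max_exit_rate q <= 1 by near: n; exact: euler_step_small.
have hc : t / n%:R * c <= 1 by near: n; exact: euler_step_small.
have h0 : 0 <= t / n%:R by rewrite divr_ge0.
move: hq hc h0; have [h hE] : exists h, h = t / n%:R by exists (t / n%:R).
rewrite -hE => hq hc h0.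
have step m j : iter m (euler q h) f j <= (1 - h * c) ^+ m * f j.
  elim: m j => [|m IH] j /=; first by rewrite mul1r.
  apply: (le_trans (le_euler _ _ _ _ q_ge0 h0 hq IH j)).
  have -> : euler q h (fun k => (1 - h * c) ^+ m * f k) j =
      (1 - h * c) ^+ m * euler q h f j.
    rewrite /euler /drift mulrDr; congr (_ + _); rewrite mulrCA; congr (_ * _).
    by rewrite mulr_sumr; apply: eq_bigr => k _; rewrite -mulrBr mulrCA.
  rewrite exprSr -mulrA ler_wpM2l// ?exprn_ge0 ?subr_ge0//.
  by rewrite /euler mulrBl mul1r lerD2l -mulrA -mulrN -mulNr ler_wpM2l.
apply: (le_trans (step _ _)); rewrite ler_wpM2r//.
have -> : - (c * t) = n%:R * (- (h * c)).
  by rewrite hE; field; rewrite pnatr_eq0 -lt0n.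
rewrite expRM_natl lerXn2r// ?nnegrE ?expR_ge0 ?subr_ge0//.
exact: expR_ge1Dx.
Unshelve. all: by end_near.
Qed.

End TransitionFunction.
End EulerScheme.

(** * Distances and the birth rate function *)

Definition dist_pos (o : option nat) : bool :=
  if o is Some n then (0 < n)%N else true.

Definition dist_le (o o' : option nat) : bool :=
  match o, o' with
  | _, None => true
  | Some n, Some n' => (n <= n')%N
  | None, Some _ => false
  end.

Section Distances.
Context {N : nat}.
Implicit Types (A B : {set 'I_N}) (x y z : 'I_N).

Lemma bigmin_nat_eq (I : finType) (P : pred I) (F : I -> nat) (M : nat) i :
  P i -> (F i <= M)%N -> (forall j, P j -> (F i <= F j)%N) ->
  \big[minn/M]_(j | P j) F j = F i.
Proof.
move=> Pi FM Fi; apply/eqP; rewrite eqn_leq; apply/andP; split.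
  have : i \in index_enum I by rewrite mem_index_enum.
  elim: (index_enum I) => // j r IH; rewrite in_cons big_cons.
  case/orP => [/eqP <-|/IH le_r]; first by rewrite Pi geq_minl.
  by case: ifP => // _; rewrite (leq_trans (geq_minr _ _)).
by apply: (big_ind (fun v => F i <= v)%N) => // a b ia ib; rewrite leq_min ia.
Qed.

(** Case analysis yields the nearest particle itself instead of a minimum of distances. *)
Variant ldist_spec A x : option nat -> Prop :=
| LdistSome y of y \in A & (y < x)%N
    & (forall z, z \in A -> (z < x)%N -> (z <= y)%N) :
    ldist_spec A x (Some (x - y)%N)
| LdistNone of (forall z, z \in A -> (x <= z)%N) : ldist_spec A x None.

Lemma ldistP A x : ldist_spec A x (ldist A x).
Proof.
rewrite /ldist; case: ifPn => [/exists_inP[y0 y0A y0x]|nex]; last first.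
  constructor => z zA; rewrite leqNgt; apply/negP => zx.
  by case/negP: nex; apply/exists_inP; exists z.
have Py0 : (y0 \in A) && (y0 < x)%N by rewrite y0A.
case: (@arg_maxnP _ y0 (fun y => (y \in A) && (y < x)%N) (@nat_of_ord N) Py0)
  => y /andP[yA yx] ymax.
rewrite (@bigmin_nat_eq _ _ _ _ y) ?yA//.
- by constructor => // z zA zx; apply: ymax; rewrite zA.
- by have := ltn_ord x; lia.
- by move=> z zx; have := ymax _ zx; case/andP: zx; lia.
Qed.

Variant rdist_spec A x : option nat -> Prop :=
| RdistSome y of y \in A & (x < y)%N
    & (forall z, z \in A -> (x < z)%N -> (y <= z)%N) :
    rdist_spec A x (Some (y - x)%N)
| RdistNone of (forall z, z \in A -> (z <= x)%N) : rdist_spec A x None.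

Lemma rdistP A x : rdist_spec A x (rdist A x).
Proof.
rewrite /rdist; case: ifPn => [/exists_inP[y0 y0A y0x]|nex]; last first.
  constructor => z zA; rewrite leqNgt; apply/negP => zx.
  by case/negP: nex; apply/exists_inP; exists z.
have Py0 : (y0 \in A) && (x < y0)%N by rewrite y0A.
case: (@arg_minnP _ y0 (fun y => (y \in A) && (x < y)%N) (@nat_of_ord N) Py0)
  => y /andP[yA yx] ymin.
rewrite (@bigmin_nat_eq _ _ _ _ y) ?yA//.
- by constructor => // z zA zx; apply: ymin; rewrite zA.
- by have := ltn_ord y; lia.
- by move=> z zx; have := ymin _ zx; case/andP: zx; lia.
Qed.

Lemma ldist_eq A x y : y \in A -> (y < x)%N ->
  (forall z, z \in A -> (z < x)%N -> (z <= y)%N) -> ldist A x = Some (x - y)%N.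
Proof.
move=> yA yx ymax; case: ldistP => [z zA zx zmax|/(_ y yA)]; last by lia.
by congr Some; have := zmax _ yA yx; have := ymax _ zA zx; lia.
Qed.

Lemma rdist_eq A x y : y \in A -> (x < y)%N ->
  (forall z, z \in A -> (x < z)%N -> (y <= z)%N) -> rdist A x = Some (y - x)%N.
Proof.
move=> yA yx ymin; case: rdistP => [z zA zx zmin|/(_ y yA)]; last by lia.
by congr Some; have := zmin _ yA yx; have := ymin _ zA zx; lia.
Qed.

Lemma ldist_none A x : (forall z, z \in A -> (x <= z)%N) -> ldist A x = None.
Proof. by move=> xmin; case: ldistP => // y /xmin; lia. Qed.

Lemma rdist_none A x : (forall z, z \in A -> (z <= x)%N) -> rdist A x = None.
Proof. by move=> xmax; case: rdistP => // y /xmax; lia. Qed.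

Lemma ldist_pos A x : dist_pos (ldist A x).
Proof. by case: ldistP => //= y _; lia. Qed.

Lemma rdist_pos A x : dist_pos (rdist A x).
Proof. by case: rdistP => //= y _; lia. Qed.

End Distances.

(** * Monotonicity of the weight and of its ratios *)

Section Weights.
Context {R : realType} {psi : nat -> R} (hpsi : nps_weight psi).

(** The ratios [psi n / psi n.+1] decrease to 1, hence are all at least 1. *)
Lemma weight_antitone m n : (1 <= m)%N -> (m <= n)%N -> psi n <= psi m.
Proof.
move=> m1; elim: n => [|n IH]; first by lia.
rewrite leq_eqVlt => /orP[/eqP<-//|]; rewrite ltnS => mn.
apply: le_trans (IH mn).
have n1 : (1 <= n)%N by lia.
suff : 1 <= psi n / psi n.+1 by rewrite ler_pdivlMr ?mul1r// (nps_gt0 hpsi).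
apply: (cvgr_to_le (nps_ratio_cvg hpsi)).
near=> k; apply: (nps_ratio_noninc hpsi) => //.
by near: k; exact: nbhs_infty_ge.
Unshelve. all: by end_near.
Qed.

(** The quotient is a telescoping product of [r] one-step ratios, each of which decreases. *)
Lemma weight_ratio_antitone m n r : (1 <= m)%N -> (m <= n)%N ->
  psi n / psi (n + r)%N <= psi m / psi (m + r)%N.
Proof.
move=> m1 mn; elim: r => [|r IH].
  by rewrite !addn0 !divff// gt_eqF// (nps_gt0 hpsi)//; lia.
have P k : (1 <= k)%N -> psi k / psi (k + r.+1)%N =
    psi k / psi (k + r)%N * (psi (k + r)%N / psi (k + r).+1).
  by move=> k1; rewrite addnS; field; rewrite !gt_eqF// (nps_gt0 hpsi)//; lia.
rewrite !P//; last by lia.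
have psi0 k : (1 <= k)%N -> 0 <= psi k by move=> /(nps_gt0 hpsi)/ltW.
apply: ler_pM => //; rewrite ?divr_ge0 ?psi0//; try lia.
by apply: (nps_ratio_noninc hpsi); lia.
Qed.

Lemma weight_partial_sum_le1 n : \sum_(1 <= i < n) psi i <= 1.
Proof.
rewrite -lee_fin -sumEFin -(nps_sum1 hpsi).
by apply: nneseries_lim_ge => i i1 _; rewrite lee_fin ltW// (nps_gt0 hpsi).
Qed.

End Weights.

Lemma sum_ord_range {R : realType} (N a b : nat) (G : nat -> R) : (b <= N)%N ->
  \sum_(x < N | (a <= x < b)%N) G x = \sum_(a <= x < b) G x.
Proof.
move=> bN; rewrite -(big_mkord (fun x => (a <= x < b)%N)).
rewrite [RHS](big_nat_widen _ _ _ _ _ bN) (big_nat_widenl _ _ _ _ _ (leq0n a)).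
by apply: eq_bigl => i; rewrite andbC.
Qed.

(** * Monotonicity of the birth rate in the distances *)

Section Beta.
Context {R : realType} {psi : nat -> R} (hpsi : nps_weight psi).
Context {lambda : R} (lambda_gt0 : 0 < lambda).

Lemma beta_sym l r : beta psi lambda l r = beta psi lambda r l.
Proof.
by case: l r => [l|] [r|] //=; rewrite [psi l * _]mulrC [(l + r)%N]addnC.
Qed.

Lemma beta_ge0 l r : dist_pos l -> dist_pos r -> 0 <= beta psi lambda l r.
Proof.
have psi0 n : (0 < n)%N -> 0 <= psi n by move=> /(nps_gt0 hpsi)/ltW.
case: l r => [l|] [r|] //= l0 r0; rewrite mulr_ge0 ?(ltW lambda_gt0) ?psi0//.
by rewrite divr_ge0 ?mulr_ge0 ?psi0//; lia.
Qed.

(** Between finite distances this is [weight_ratio_antitone]. Passing from [Some l] to infinity with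
    [r] finite amounts to [psi (l + r) <= psi l]. *)
Lemma beta_antitone_l l l' r : dist_pos l -> dist_pos r -> dist_le l l' ->
  beta psi lambda l' r <= beta psi lambda l r.
Proof.
have psi0 n : (0 < n)%N -> 0 < psi n by exact: nps_gt0.
case: l l' r => [l|] [l'|] [r|] //= l0 r0 ll'; rewrite ?ler_pM2l//.
- rewrite -!mulrA ![psi r / _]mulrC !mulrA ler_pM2r ?psi0//.
  exact: weight_ratio_antitone.
- exact: weight_antitone.
- rewrite ler_pdivlMr ?psi0 1?mulrC ?ler_pM2r ?psi0//; try lia.
  by apply: (weight_antitone hpsi) => //; lia.
- by rewrite mulr_ge0 ?ltW ?psi0.
Qed.

Lemma beta_antitone l l' r r' : dist_pos l -> dist_pos r -> dist_pos r' ->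
  dist_le l l' -> dist_le r r' -> beta psi lambda l' r' <= beta psi lambda l r.
Proof.
move=> l0 r0 r'0 ll' rr'; apply: (le_trans (beta_antitone_l _ _ _ l0 r'0 ll')).
by rewrite ![beta _ _ l _]beta_sym; exact: beta_antitone_l.
Qed.

End Beta.

(** * Total birth rate, attractiveness *)

Section Birth.
Context {R : realType} {psi : nat -> R} (hpsi : nps_weight psi).
Context {lambda : R} (lambda_gt0 : 0 < lambda) {N : nat}.
Implicit Types (A B : {set 'I_N}) (x y z : 'I_N).

Definition birth A x : R := beta psi lambda (ldist A x) (rdist A x).

Lemma birth_ge0 A x : 0 <= birth A x.
Proof. by apply: (beta_ge0 hpsi lambda_gt0); rewrite ?ldist_pos ?rdist_pos. Qed.

Lemma birth_set0 x : birth finset.set0 x = 0.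
Proof. by rewrite /birth ldist_none ?rdist_none// => z; rewrite inE. Qed.

(** Attractiveness: extra particles can only shorten the distances seen from [x]. *)
Lemma birth_monotone A B x : A \subset B -> birth A x <= birth B x.
Proof.
move=> /fintype.subsetP AB.
apply: (beta_antitone hpsi lambda_gt0); rewrite ?ldist_pos ?rdist_pos//.
- case: (ldistP A) => [y /AB yB yx _|_]; last by case: (ldist B x).
  by case: ldistP => [z zB zx /(_ _ yB yx)|/(_ _ yB)] /=; lia.
- case: (rdistP A) => [y /AB yB yx _|_]; last by case: (rdist B x).
  by case: rdistP => [z zB zx /(_ _ yB yx)|/(_ _ yB)] /=; lia.
Qed.

Lemma nps_rate_ge0 A B : 0 <= nps_rate psi lambda A B.
Proof. by apply: addr_ge0; apply: sumr_ge0 => // x _; exact: birth_ge0. Qed.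

Lemma drift_nps (f : {set 'I_N} -> R) A : drift (nps_rate psi lambda) f A =
  \sum_(x in A) (f (A :\ x)%SET - f A)
  + \sum_(x | x \notin A) birth A x * (f (x |: A)%SET - f A).
Proof.
rewrite /drift /nps_rate; under eq_bigr do rewrite mulrDl !mulr_suml.
rewrite big_split/=; congr (_ + _).
- rewrite (exchange_big_dep (mem A))/=; last by move=> B x _ /andP[].
  apply: eq_bigr => x xA; rewrite (big_pred1 (A :\ x)%SET) ?mul1r// => B.
  by rewrite xA.
- rewrite (exchange_big_dep (fun x => x \notin A))/=; last by move=> B x _ /andP[].
  apply: eq_bigr => x xA; rewrite (big_pred1 (x |: A)%SET)// => B.
  by rewrite xA.
Qed.

(** Membership of [y] in [A] is left to the places of use; what is encoded is that no particle lies
    strictly between [y] and [x]. *)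
Definition left_neighbour A y x : bool :=
  (y < x)%N && [forall (z | z \in A), (z < x)%N ==> (z <= y)%N].

(** Charges the birth at [x] to the nearest particle on its left, or to the left end gap if there is
    none. *)
Lemma birth_le_left_neighbours A x : birth A x <=
  \sum_(y in A) (if left_neighbour A y x then birth A x else 0)
  + (if ldist A x == None then birth A x else 0).
Proof.
case: (ldistP A x) => [y yA yx ymax|_]; last first.
  by rewrite eqxx lerDr sumr_ge0// => y _; case: ifP => // _; exact: birth_ge0.
rewrite addr0 (bigD1 y)//= /left_neighbour yx /= ifT.
  by rewrite lerDl sumr_ge0// => z _; case: ifP => // _; exact: birth_ge0.
by apply/forall_inP => z zA; apply/implyP; exact: ymax.
Qed.

(** * Total birth rate, gap by gap *)

Context (mu : R) (mu_lambda : lambda <= mu)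
  (mu_conv : forall n, (2 <= n)%N ->
     lambda * \sum_(1 <= l < n) psi l * psi (n - l)%N <= mu * psi n).

Lemma one_sided_sum_right (y u : nat) : (u <= N)%N ->
  \sum_(x < N | (y < x < u)%N) lambda * psi (x - y)%N <= mu.
Proof.
move=> uN; rewrite (sum_ord_range N y.+1 u (fun x : nat => lambda * psi (x - y)%N))//.
rewrite -mulr_sumr -add1n big_addn.
under eq_bigr do rewrite addnK.
by rewrite (le_trans _ mu_lambda)// ler_piMr ?(ltW lambda_gt0)// weight_partial_sum_le1.
Qed.

Lemma one_sided_sum_left (u : nat) : (u <= N)%N ->
  \sum_(x < N | (x < u)%N) lambda * psi (u - x)%N <= mu.
Proof.
move=> uN; rewrite (sum_ord_range N 0 u (fun x : nat => lambda * psi (u - x)%N))//.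
rewrite -mulr_sumr big_nat_rev/= add0n (_ : \sum_(0 <= i < u) _ =
  \sum_(1 <= i < u.+1) psi i).
  by rewrite (le_trans _ mu_lambda)// ler_piMr ?(ltW lambda_gt0)// weight_partial_sum_le1.
by rewrite big_add1/=; apply: eq_big_nat => i iu; congr psi; lia.
Qed.

(** After a shift by [y] this is the convolution of [psi] with itself at [u - y], divided by
    [psi (u - y)], which [mu_conv] controls. *)
Lemma two_sided_sum (y u : nat) : (y < u)%N -> (u <= N)%N ->
  \sum_(x < N | (y < x < u)%N)
     lambda * (psi (x - y)%N * psi (u - x)%N / psi ((x - y) + (u - x))%N) <= mu.
Proof.
move=> yu uN.
rewrite (sum_ord_range N y.+1 u (fun x : nat => lambda * (psi (x - y)%N *
  psi (u - x)%N / psi ((x - y) + (u - x))%N)))//.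
rewrite -mulr_sumr -add1n big_addn.
rewrite (eq_big_nat _ _ (F2 := fun l => psi l * psi (u - y - l)%N / psi (u - y)%N));
  last first.
  move=> l /andP[l1 lu]; rewrite addnK.
  have -> : (l + (u - (l + y)) = u - y)%N by lia.
  by have -> : (u - (l + y) = u - y - l)%N by lia.
have psi_uy : 0 < psi (u - y)%N by apply: (nps_gt0 hpsi); lia.
rewrite -mulr_suml mulrA ler_pdivrMr//.
(* A gap of length 1 contains no vacant site, so the remaining sum is empty. *)
have [uy2|uy2] := leqP 2 (u - y); first exact: mu_conv.
rewrite big_geq ?mulr0; last by lia.
by rewrite mulr_ge0 ?(ltW psi_uy)// (le_trans _ mu_lambda)// ltW.
Qed.

(** The sites concerned lie between [y] and the next particle [u], or between [y] and the right end,
    so a two-sided or a one-sided sum applies. *)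
Lemma birth_sum_right_of A y : y \in A ->
  \sum_(x | (x \notin A) && left_neighbour A y x) birth A x <= mu.
Proof.
have psi0 n : (0 < n)%N -> 0 <= psi n by move=> /(nps_gt0 hpsi)/ltW.
have lE x : y \in A -> left_neighbour A y x -> ldist A x = Some (x - y)%N.
  move=> yA /andP[yx /forall_inP ymax]; apply: ldist_eq => // z zA.
  exact/implyP/ymax.
move=> yA; case: (rdistP A y) => [u uA yu umin|ymax].
- apply: le_trans (two_sided_sum y u yu (ltnW (ltn_ord u))).
  have xu x : x \notin A -> left_neighbour A y x -> (x < u)%N.
    move=> xA /andP[yx /forall_inP /(_ u uA) /implyP H].
    rewrite ltnNge leq_eqVlt; apply/negP => /orP[/eqP/val_inj ux|/H]; last by lia.
    by move: xA; rewrite -ux uA.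
  rewrite [leLHS]big_mkcond [leRHS]big_mkcond; apply: ler_sum => x _.
  case: ifPn => [/andP[xA yx]|_]; last first.
    case: ifPn => // /andP[yx xu']; rewrite mulr_ge0 ?(ltW lambda_gt0)//.
    by rewrite divr_ge0 ?mulr_ge0 ?psi0//; lia.
  have [yx' _] := andP yx.
  rewrite yx' xu//= /birth lE// (@rdist_eq _ A x u) ?xu//.
  by move=> z zA xz; apply: umin => //; exact: ltn_trans xz.
- apply: le_trans (one_sided_sum_right y N (leqnn N)).
  rewrite [leLHS]big_mkcond [leRHS]big_mkcond; apply: ler_sum => x _.
  rewrite ltn_ord andbT.
  case: ifPn => [/andP[xA yx]|_]; last first.
    by case: ifPn => // yx; rewrite mulr_ge0 ?(ltW lambda_gt0)// psi0//; lia.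
  have [yx' _] := andP yx.
  by rewrite yx' /birth lE// rdist_none// => z /ymax; lia.
Qed.

Lemma birth_sum_left_of A :
  \sum_(x | (x \notin A) && (ldist A x == None)) birth A x <= mu.
Proof.
have psi0 n : (0 < n)%N -> 0 <= psi n by move=> /(nps_gt0 hpsi)/ltW.
have [->|[a aA]] := set_0Vmem A.
  by rewrite big1 => [|x _]; rewrite ?birth_set0// (le_trans _ mu_lambda)// ltW.
case: (@arg_minnP _ a (fun y => y \in A) (@nat_of_ord N) aA) => u uA umin.
apply: le_trans (one_sided_sum_left u (ltnW (ltn_ord u))).
rewrite [leLHS]big_mkcond [leRHS]big_mkcond; apply: ler_sum => x _.
case: ifPn => [/andP[xA /eqP xl]|_]; last first.
  by case: ifPn => // xu; rewrite mulr_ge0 ?(ltW lambda_gt0)// psi0//; lia.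
have xu : (x < u)%N.
  rewrite ltnNge leq_eqVlt; apply/negP => /orP[/eqP/val_inj ux|ux].
    by move: xA; rewrite -ux uA.
  by case: ldistP xl => // /(_ u uA); lia.
by rewrite xu /birth xl (@rdist_eq _ A x u)// => z zA _; exact: umin.
Qed.

(** Each particle accounts for the gap on its right, and the left end adds one more gap; every gap
    contributes at most [mu]. *)
Lemma birth_sum_le A : \sum_(x | x \notin A) birth A x <= mu * (#|A|.+1)%:R.
Proof.
apply: (le_trans (ler_sum _ (fun x _ => birth_le_left_neighbours A x))).
rewrite big_split/= -natr1 mulrDr mulr1 exchange_big/= mulr_natr -sumr_const.
apply: lerD; last by rewrite -big_mkcondr; exact: birth_sum_left_of.
by apply: ler_sum => y yA; rewrite -big_mkcondr; exact: birth_sum_right_of.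
Qed.

End Birth.

(** * Exponential decay in the subcritical case *)

Section Subcritical.
Context {R : realType} {psi : nat -> R} (hpsi : nps_weight psi).
Context {lambda : R} (lambda_gt0 : 0 < lambda) {N : nat}.
Context (mu : R) (mu_lambda : lambda <= mu) (mu_lt1 : mu < 1)
  (mu_conv : forall n, (2 <= n)%N ->
     lambda * \sum_(1 <= l < n) psi l * psi (n - l)%N <= mu * psi n).

(* The increment [1 + M / k] makes the death rate [k] beat the birth rate
   [mu * (k + 1)] for every [k >= 1], including [k = 1]. *)
Definition lyapunov (k : nat) : R := \sum_(i < k) (1 + mu / (1 - mu) / i.+1%:R).

Let mu_gt0 : 0 < mu. Proof. exact: lt_le_trans mu_lambda. Qed.

Let M_ge0 : 0 <= mu / (1 - mu).
Proof. by rewrite divr_ge0 ?(ltW mu_gt0)// subr_ge0 ltW. Qed.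

Lemma lyapunovS k : lyapunov k.+1 = lyapunov k + (1 + mu / (1 - mu) / k.+1%:R).
Proof. by rewrite /lyapunov big_ord_recr. Qed.

Lemma lyapunov_ge0 k : 0 <= lyapunov k.
Proof. by apply: sumr_ge0 => i _; rewrite addr_ge0// divr_ge0. Qed.

Lemma lyapunov_ge1 k : (0 < k)%N -> 1 <= lyapunov k.
Proof.
case: k => // k _; rewrite lyapunovS addrCA lerDl addr_ge0 ?lyapunov_ge0//.
by rewrite divr_ge0.
Qed.

(** Every increment is at most [1 + mu / (1 - mu) = 1 / (1 - mu)]. *)
Lemma lyapunov_le k : lyapunov k <= k%:R / (1 - mu).
Proof.
elim: k => [|k IH]; first by rewrite /lyapunov big_ord0 mul0r.
rewrite lyapunovS -[in leRHS]natr1 mulrDl lerD//.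
rewrite -[leRHS](_ : 1 + mu / (1 - mu) = _); last first.
  by field; rewrite subr_eq0 gt_eqF.
by rewrite lerD2l ler_pdivrMr// ler_peMr// ler1n.
Qed.

(** Put [M = mu / (1 - mu)]. With [k >= 1] particles, deaths contribute [- (k + M)] and births at
    most [mu * (k + 1 + M)]. Since [(1 - mu) * M = mu], the sum is [- (1 - mu) * k], and
    [lyapunov_le] converts [k] back into [lyapunov k]. *)
Lemma drift_lyapunov (A : {set 'I_N}) :
  drift (nps_rate psi lambda) (fun B => lyapunov #|B|) A
    <= - (1 - mu) ^+ 2 * lyapunov #|A|.
Proof.
have mu1 : 0 < 1 - mu by rewrite subr_gt0.
rewrite drift_nps.
have [->|A0] := eqVneq A finset.set0.
  rewrite big1 ?big1 ?cards0 => [|x _|x]; rewrite ?birth_set0 ?mul0r ?inE//.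
  by rewrite /lyapunov big_ord0 mulr0 addr0.
have A1 : (0 < #|A|)%N by rewrite card_gt0.
case E : #|A| A1 => [//|k] _.
rewrite [X in X + _](_ : _ = - (k.+1%:R + mu / (1 - mu))); last first.
  rewrite (eq_bigr (fun=> - (1 + mu / (1 - mu) / k.+1%:R))) => [|x xA].
    by rewrite sumr_const E -mulr_natr; field; rewrite gt_eqF//= pnatr_eq0.
  by have := cardsD1 x A; rewrite xA E add1n => -[<-]; rewrite lyapunovS; ring.
have : \sum_(x | x \notin A)
    birth (psi := psi) (lambda := lambda) A x * (lyapunov #|(x |: A)%SET| - lyapunov k.+1) <=
    mu * (k.+2%:R + mu / (1 - mu)).
  rewrite (eq_bigr (fun x => birth (psi := psi) (lambda := lambda) A x *
      (1 + mu / (1 - mu) / k.+2%:R))) => [|x xA]; last first.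
    by rewrite cardsU1 xA E add1n [in lyapunov k.+2]lyapunovS; ring.
  rewrite -mulr_suml.
  have -> : mu * (k.+2%:R + mu / (1 - mu)) =
      (mu * k.+2%:R) * (1 + mu / (1 - mu) / k.+2%:R).
    by rewrite -mulrA; congr (mu * _); rewrite mulrDr mulr1 [k.+2%:R * (_ / _)]mulrCA divff ?mulr1// pnatr_eq0.
  rewrite ler_wpM2r ?addr_ge0 ?divr_ge0 ?(ltW mu_gt0) ?(ltW mu1)//.
  by have := birth_sum_le hpsi lambda_gt0 mu mu_lambda mu_conv A; rewrite E.
have := lyapunov_le k.+1.
rewrite -(ler_pM2l (exprn_gt0 2 mu1)).
rewrite (_ : _ ^+ 2 * (_ / _) = k.+1%:R * (1 - mu)); last first.
  by field; rewrite gt_eqF.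
move=> H1 H2.
have H3 : - (k.+1%:R + mu / (1 - mu)) + mu * (k.+2%:R + mu / (1 - mu)) =
  - (k.+1%:R * (1 - mu)).
  by rewrite -(natr1 k.+1); field; rewrite gt_eqF.
by rewrite mulNr; lra.
Qed.

(** A Markov inequality: [lyapunov] vanishes at 0 and is at least 1 on nonempty configurations, so
    its decaying expectation dominates the survival probability. *)
Lemma survival_bound (p : R -> {set 'I_N} -> {set 'I_N} -> R) (t : R) :
  is_transition_function (nps_rate psi lambda) p -> 0 <= t ->
  1 - p t [set: 'I_N]%SET finset.set0
    <= N%:R / (1 - mu) * expR (- ((1 - mu) ^+ 2 * t)).
Proof.
move=> hp t0.
have := @expect_decay _ _ _ _ (nps_rate_ge0 hpsi lambda_gt0) hp ((1 - mu) ^+ 2) t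
   (fun B => lyapunov #|B|) t0 (sqr_ge0 _) (fun B => lyapunov_ge0 _)
   drift_lyapunov [set: 'I_N]%SET.
rewrite cardsT card_ord => H.
rewrite mulrC (le_trans _ (le_trans H _)) ?ler_wpM2l ?expR_ge0 ?lyapunov_le//.
rewrite -(trf_sum1 hp [set: 'I_N]%SET t0) (bigD1 finset.set0)//=.
rewrite addrAC subrr add0r /expect [leRHS](bigD1 finset.set0)//=.
rewrite cards0 /lyapunov big_ord0 mulr0 add0r; apply: ler_sum => B B0.
by rewrite ler_peMr ?(trf_ge0 hp)// lyapunov_ge1// card_gt0.
Qed.

End Subcritical.

(** * Reversibility *)

Section Reversibility.
Context {R : realType} {psi : nat -> R} (hpsi : nps_weight psi).
Context {lambda : R} (lambda_gt0 : 0 < lambda) {N : nat}.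
Implicit Types (A B : {set 'I_N}) (x y z : 'I_N).

(** Each particle carries the weight of the gap on its right; the rightmost one carries 1. *)
Definition gap_weight A x : R := if rdist A x is Some r then psi r else 1.

Definition rev_measure A : R := lambda ^+ #|A| * \prod_(x in A) gap_weight A x.

Lemma gap_weight_gt0 A x : 0 < gap_weight A x.
Proof.
rewrite /gap_weight; case E: (rdist A x) => [r|//].
by apply: (nps_gt0 hpsi); have := rdist_pos A x; rewrite E.
Qed.

Lemma rev_measure_gt0 A : 0 < rev_measure A.
Proof. by rewrite mulr_gt0 ?exprn_gt0// prodr_gt0// => x _; exact: gap_weight_gt0. Qed.

Lemma rev_measure1 x : rev_measure [set x]%SET = lambda.
Proof.
rewrite /rev_measure cards1 big_set1 /gap_weight rdist_none ?mulr1//.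
by move=> z; rewrite inE => /eqP ->.
Qed.

Lemma rdist_setU1_self A x : rdist (x |: A)%SET x = rdist A x.
Proof.
case: (rdistP A x) => [u uA xu umin|xmax].
  apply: rdist_eq => //; first by rewrite !inE uA orbT.
  by move=> z; rewrite !inE => /orP[/eqP->|zA]; [lia|exact: umin].
by apply: rdist_none => z; rewrite !inE => /orP[/eqP->|/xmax].
Qed.

Lemma rdist_setU1_left A x y : left_neighbour A y x ->
  rdist (x |: A)%SET y = Some (x - y)%N.
Proof.
move=> /andP[yx /forall_inP ymax]; apply: rdist_eq => //; first by rewrite !inE eqxx.
move=> z; rewrite !inE => /orP[/eqP->//|zA yz].
by have /implyP := ymax z zA; case: leqP => // zx /(_ isT); lia.
Qed.

(** Either [x] lies to the left of [z], or some particle of [A] already separates [z] from [x]. *)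
Lemma rdist_setU1_other A x z : z \in A -> x \notin A -> ~~ left_neighbour A z x ->
  rdist (x |: A)%SET z = rdist A z.
Proof.
move=> zA xA; rewrite negb_and -leqNgt => nleft.
have xz : x <> z by move=> xz; move: xA; rewrite xz zA.
have {}xz : nat_of_ord x <> z by move=> /val_inj.
case: (rdistP A z) => [u uA zu umin|zmax].
  apply: rdist_eq => //; first by rewrite !inE uA orbT.
  move=> w; rewrite !inE => /orP[/eqP->|wA]; last exact: umin.
  move=> zx; case/orP: nleft; first by lia.
  move=> /forall_inPn[v vA]; rewrite negb_imply -ltnNge => /andP[vx zv].
  by have := umin v vA zv; lia.
apply: rdist_none => w; rewrite !inE => /orP[/eqP->|/zmax//].
case/orP: nleft => // /forall_inPn[v vA]; rewrite negb_imply -ltnNge.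
by have := zmax v vA; lia.
Qed.

(** Detailed balance, deaths having rate 1: inserting [x] into a gap from [y] to [u] replaces
    [psi (u - y)] by [lambda * psi (x - y) * psi (u - x)]. In an end gap only one new factor of
    [psi] appears. *)
Lemma rev_measure_setU1 A x : x \notin A -> A != finset.set0 ->
  rev_measure (x |: A)%SET = birth (psi := psi) (lambda := lambda) A x * rev_measure A.
Proof.
move=> xA A0.
rewrite /rev_measure cardsU1 xA exprS (big_setU1 _ xA)/=.
rewrite {1}/gap_weight rdist_setU1_self /birth.
case: (ldistP A x) => [y yA yx ymax|xmin].
  have yl : left_neighbour A y x.
    by rewrite /left_neighbour yx; apply/forall_inP => z zA; apply/implyP; exact: ymax.
  rewrite (bigD1 y)//= [in RHS](bigD1 y)//=.
  rewrite (eq_bigr (gap_weight A)) => [|z /andP[zA zy]]; last first.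
    rewrite /gap_weight rdist_setU1_other//; apply: contra zy.
    move=> /andP[zx /forall_inP/(_ y yA)/implyP/(_ yx) yz].
    by apply/eqP/val_inj/eqP; rewrite eqn_leq yz ymax.
  rewrite {1}/gap_weight rdist_setU1_left//.
  case: (rdistP A x) => [u uA xu umin|xmax] /=.
    rewrite /gap_weight (@rdist_eq _ A y u) //; last first.
    - move=> z zA yz; have [zx|zx] := ltnP x z; first exact: umin.
      have : nat_of_ord z <> x by move=> /val_inj zx'; move: xA; rewrite -zx' zA.
      by move=> zx'; have := ymax z zA; lia.
    - lia.
    have -> : (x - y + (u - x) = u - y)%N by lia.
    by field; rewrite gt_eqF// (nps_gt0 hpsi)//; lia.
  rewrite /gap_weight rdist_none; first by ring.
  move=> z zA; apply: ymax => //; have := xmax z zA.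
  rewrite leq_eqVlt => /orP[/eqP/val_inj zx'|//].
  by move: xA; rewrite -zx' zA.
rewrite (eq_bigr (gap_weight A)) => [|z zA]; last first.
  rewrite /gap_weight rdist_setU1_other// /left_neighbour ltnNge xmin//.
case: (rdistP A x) => [u uA xu umin|xmax] /=; first by ring.
(* Both distances cannot be infinite, since [A] is nonempty and avoids [x]. *)
have /set0Pn[z zA] := A0.
have zx : z = x by apply/val_inj/eqP; rewrite eqn_leq xmin// xmax.
by move: xA; rewrite -zx zA.
Qed.

(* All jumps between nonempty configurations cancel by reversibility. *)
Lemma sum_rev_measure_drift (f : {set 'I_N} -> R) :
  \sum_(A | A != finset.set0) rev_measure A * drift (nps_rate psi lambda) f A =
  \sum_x lambda * (f finset.set0 - f [set x]%SET).
Proof.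
under eq_bigr do rewrite drift_nps mulrDr !mulr_sumr.
rewrite big_split/= (exchange_big_dep predT)//= [X in _ + X](exchange_big_dep predT)//=.
rewrite -big_split/=; apply: eq_bigr => x _.
(* Births at [x] are reindexed by the configuration they produce, to be matched with the deaths at
   [x]. *)
rewrite [X in _ + X](reindex_onto (fun A => A :\ x)%SET (fun A => x |: A)%SET)/=; last first.
  by move=> A /andP[_ xA]; rewrite setU1K.
(* The death from [[set x]] leads to the empty set and has no matching birth; it is the term that
   survives. *)
rewrite (bigD1 [set x]%SET)/=; last first.
  by rewrite !inE eqxx andbT; apply/set0Pn; exists x; rewrite inE.
rewrite rev_measure1 finset.setDv.
rewrite [X in _ + X](eq_big (fun A => ((A != finset.set0) && (x \in A)) && (A != [set x]%SET))
  (fun A => - (rev_measure A * (f (A :\ x)%SET - f A)))).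
- by rewrite sumrN addrK.
- move=> A; rewrite !inE eqxx andbT.
  have [xA|xA] := boolP (x \in A).
    rewrite finset.setD1K// eqxx !andbT.
    have -> : A != finset.set0 by apply/set0Pn; exists x.
    rewrite /= -finset.subset0 finset.subDset finset.setU0 finset.subset1 negb_or.
    have -> : A != finset.set0 by apply/set0Pn; exists x.
    by rewrite andbT.
  rewrite andbF /=; apply/negP => /andP[_ /eqP AE].
  by move: xA; rewrite -AE !inE eqxx.
- move=> A /andP[/andP[A0 xA]] /eqP AE.
  by rewrite mulrA [rev_measure _ * _]mulrC -rev_measure_setU1// AE -mulrN opprB.
Qed.

End Reversibility.

(** * Extinction probability in the supercritical case *)

Section Supercritical.
Context {R : realType} {psi : nat -> R} (hpsi : nps_weight psi).
Context {lambda : R} (lambda_gt0 : 0 < lambda) {N : nat}.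
Implicit Types (A B : {set 'I_N}) (x y z : 'I_N).

Local Notation q := (@nps_rate R psi lambda N).
Local Notation b := (@birth R psi lambda N).
Local Notation nu := (@rev_measure R psi lambda N).

Let antitone_setU1 (f : {set 'I_N} -> R) :=
  forall A y, y \notin A -> f (y |: A)%SET <= f A.

(** Dominates, for each [A], all flip rates of [A] plus the death rate 1 of one additional
    particle. *)
Definition flip_rate_bound : R :=
  \sum_(A : {set 'I_N}) (#|A|.+1%:R + \sum_(x | x \notin A) b A x).

(** The basic coupling of [A] and [y |: A] in algebraic form: common deaths and common births keep
    the two ordered, and the larger configuration has extra births at rate [b (y |: A) x - b A x],
    nonnegative by attractiveness. *)
Lemma euler_antitone h f : 0 <= h -> h * flip_rate_bound <= 1 ->
  antitone_setU1 f -> antitone_setU1 (euler q h f).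
Proof.
move=> h0 hK fanti A y yA; rewrite -subr_ge0.
set v := f A - f (y |: A)%SET.
have v0 : 0 <= v by rewrite subr_ge0 fanti.
have f_anti2 x B : x \notin B -> 0 <= f B - f (x |: B)%SET.
  by move=> xB; rewrite subr_ge0 fanti.
have -> : euler q h f A - euler q h f (y |: A)%SET =
    v * (1 - h * (#|A|.+1%:R + \sum_(x | x \notin A) b A x))
    + h * (\sum_(x in A) (f (A :\ x)%SET - f (y |: A :\ x)%SET)
       + \sum_(x | x \notin (y |: A)%SET)
         ((b (y |: A)%SET x - b A x) * (f (y |: A)%SET - f (x |: (y |: A))%SET)
           + b A x * (f (x |: A)%SET - f (y |: (x |: A))%SET))).
  rewrite /euler !drift_nps.
  rewrite [X in _ - (_ + h * (X + _))](big_setU1 _ yA)/= setU1K//.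
  rewrite [X in (_ + h * (_ + X)) - _](bigD1 y)//=.
  rewrite [X in v * (1 - h * (_ + X))](bigD1 y)//=.
  have cE x : (x \notin A) && (x != y) = (x \notin (y |: A)%SET).
    by rewrite !inE negb_or andbC.
  rewrite !(eq_bigl _ _ cE).
  have -> : \sum_(x in A) (f ((y |: A) :\ x)%SET - f (y |: A)%SET) =
      \sum_(x in A) (f (y |: A :\ x)%SET - f (y |: A)%SET).
    apply: eq_bigr => x xA; congr (f _ - _); apply/setP => z; rewrite !inE.
    case: (eqVneq z x) => [->|_] //=; rewrite orbF; apply/esym/negbTE.
    by apply: contraNneq yA => <-.
  have -> : \sum_(x | x \notin (y |: A)%SET)
      ((b (y |: A)%SET x - b A x) * (f (y |: A)%SET - f (x |: (y |: A))%SET)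
        + b A x * (f (x |: A)%SET - f (y |: (x |: A))%SET)) =
     \sum_(x | x \notin (y |: A)%SET) b A x * (f (x |: A)%SET - f A)
     - \sum_(x | x \notin (y |: A)%SET) b (y |: A)%SET x * (f (x |: (y |: A))%SET - f (y |: A)%SET)
     + (\sum_(x | x \notin (y |: A)%SET) b A x) * v.
    rewrite mulr_suml -sumrB -big_split/=; apply: eq_bigr => x _.
    by rewrite /v (finset.setUCA [set x]%SET); ring.
  have sumBc (F : 'I_N -> R) c : \sum_(x in A) (F x - c) = \sum_(x in A) F x - c * #|A|%:R.
    by rewrite sumrB sumr_const mulr_natr.
  rewrite !sumBc [\sum_(x in A) (_ - f (y |: A :\ x)%SET)]sumrB -natr1 /v; ring.
have bA0 : 0 <= \sum_(x | x \notin A) b A x.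
  by apply: sumr_ge0 => x _; exact: birth_ge0.
apply: addr_ge0; apply: mulr_ge0 => //.
- rewrite subr_ge0 (le_trans _ hK)// ler_wpM2l// /flip_rate_bound [leRHS](bigD1 A)//= lerDl.
  apply: sumr_ge0 => B _; rewrite addr_ge0//; apply: sumr_ge0 => x _.
  exact: birth_ge0.
- apply: addr_ge0; apply: sumr_ge0 => x xA.
    by apply: f_anti2; rewrite !inE negb_and yA orbT.
  have [xA' xy] : x \notin A /\ x != y.
    by move: xA; rewrite !inE negb_or => /andP[].
  apply: addr_ge0; apply: mulr_ge0; rewrite ?birth_ge0//.
  + by rewrite subr_ge0; apply: (birth_monotone hpsi lambda_gt0); exact: finset.subsetU1.
  + exact: f_anti2.
  + by apply: f_anti2; rewrite !inE negb_or yA eq_sym xy.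
Qed.

(** The missing sites are filled in one at a time. *)
Lemma antitone_setT f A : antitone_setU1 f -> f [set: 'I_N]%SET <= f A.
Proof.
move=> fanti; have [n] := ubnP #|~: A|; elim: n A => // n IH A.
rewrite ltnS => cA; have [E|[x]] := set_0Vmem (~: A)%SET.
  by rewrite -[A]finset.setCK E finset.setC0.
rewrite inE => xA; apply: le_trans (fanti A x xA); apply: IH.
rewrite (leq_trans _ cA)//; apply: proper_card; rewrite finset.properC.
by apply/fintype.properP; split; [exact: finset.subsetU1|exists x; rewrite ?inE ?eqxx].
Qed.

Lemma euler_set0 h f : euler q h f finset.set0 = f finset.set0.
Proof.
rewrite /euler drift_nps [X in h * (X + _)]big1 => [|x]; last by rewrite inE.
rewrite big1 => [|x _]; last by rewrite birth_set0 mul0r.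
by rewrite addr0 mulr0 addr0.
Qed.

Lemma iter_euler_set0 h f n : iter n (euler q h) f finset.set0 = f finset.set0.
Proof. by elim: n => //= n IH; rewrite euler_set0. Qed.

Section TransitionFunction.
Context (p : R -> {set 'I_N} -> {set 'I_N} -> R) (hp : is_transition_function q p).

Let dead (A : {set 'I_N}) : R := (A == finset.set0)%:R.

Let dead_cvg t A : 0 <= t ->
  iter n (euler q (t / n%:R)) dead A @[n --> \oo] --> expect p t dead A.
Proof. exact: (@euler_cvg _ _ _ _ (nps_rate_ge0 hpsi lambda_gt0) hp). Qed.

Lemma expect_dead t A : expect p t dead A = p t A finset.set0.
Proof.
rewrite /expect (bigD1 finset.set0)//= /dead eqxx mulr1 big1 ?addr0// => B B0.
by rewrite (negbTE B0) mulr0.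
Qed.

Lemma set0_absorbing t : 0 <= t -> p t finset.set0 finset.set0 = 1.
Proof.
move=> t0; rewrite -expect_dead.
have /cvg_lim <- // := dead_cvg t finset.set0 t0.
under eq_fun do rewrite iter_euler_set0 /dead eqxx.
exact: lim_cst.
Qed.

(** The indicator [dead] is antitone; Euler steps preserve this, and so does the limit. *)
Lemma extinction_from_full_le t A : 0 <= t ->
  p t [set: 'I_N]%SET finset.set0 <= p t A finset.set0.
Proof.
move=> t0; rewrite -!expect_dead.
apply: (ler_cvg_to (dead_cvg t _ t0) (dead_cvg t _ t0)).
near=> n; apply: antitone_setT.
have hK : t / n%:R * flip_rate_bound <= 1 by near: n; exact: euler_step_small.
have h0 : 0 <= t / n%:R by rewrite divr_ge0.
move: (t / n%:R) h0 hK => h h0 hK.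
elim: (n) => /= [|m IH]; last exact: euler_antitone.
move=> B y _; rewrite /dead (_ : (y |: B)%SET == finset.set0 = false)//.
by apply/negbTE/set0Pn; exists y; rewrite !inE eqxx.
Unshelve. all: by end_near.
Qed.

Lemma iter_euler_dead_ge0 h n A : 0 <= h -> h * max_exit_rate q <= 1 ->
  0 <= iter n (euler q h) dead A.
Proof.
move=> h0 hq; elim: n A => [|n IH] A /=; first exact: ler0n.
rewrite -[leLHS](euler_cst q h 0 A).
exact: (le_euler _ _ _ _ (nps_rate_ge0 hpsi lambda_gt0)).
Qed.

(** By [sum_rev_measure_drift], mass leaks into the empty set only from the [N] singletons, each of
    weight [lambda], hence by at most [lambda * N * h] per step. *)
Lemma rev_measure_iter_euler h n : 0 <= h -> h * max_exit_rate q <= 1 ->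
  \sum_(A | A != finset.set0) nu A * iter n (euler q h) dead A
    <= lambda * N%:R * (n%:R * h).
Proof.
move=> h0 hq; elim: n => [|n IH] /=.
  by rewrite mul0r mulr0 big1// => A A0; rewrite /dead (negbTE A0) mulr0.
under eq_bigr do rewrite /euler mulrDr mulrCA.
rewrite big_split/= -mulr_sumr sum_rev_measure_drift//.
rewrite -natr1 mulrDl mul1r mulrDr lerD// mulrC ler_wpM2r//.
rewrite mulr_natr -[X in _ *+ X](card_ord N) -sumr_const.
apply: ler_sum => x _; rewrite ler_piMr ?(ltW lambda_gt0)// lerBlDr.
by rewrite iter_euler_set0 /dead eqxx lerDl iter_euler_dead_ge0.
Qed.

Lemma rev_measure_extinction t : 0 <= t ->
  \sum_(A | A != finset.set0) nu A * p t A finset.set0 <= lambda * N%:R * t.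
Proof.
move=> t0; under eq_bigr do rewrite -expect_dead.
have cvgA : \sum_(A | A != finset.set0) nu A * iter n (euler q (t / n%:R)) dead A
    @[n --> \oo] --> \sum_(A | A != finset.set0) nu A * expect p t dead A.
  apply: cvg_big => [|A _]; first exact: add_continuous.
  by apply: cvgMr; exact: dead_cvg.
apply: (cvgr_to_le cvgA); near=> n.
have hq : t / n%:R * max_exit_rate q <= 1 by near: n; exact: euler_step_small.
have n0 : (0 < n)%N by near: n; exact: nbhs_infty_gt.
have {2}-> : t = n%:R * (t / n%:R) by rewrite mulrC divfK// pnatr_eq0 -lt0n.
by apply: rev_measure_iter_euler => //; rewrite divr_ge0.
Unshelve. all: by end_near.
Qed.

End TransitionFunction.

(** * Exponential growth of the reversible mass *)

Definition is_min A x : bool := (x \in A) && [forall (z | z \in A), (x <= z)%N].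

Lemma is_min_inj A x y : is_min A x -> is_min A y -> x = y.
Proof.
move=> /andP[xA /forall_inP xmin] /andP[yA /forall_inP ymin].
by apply/val_inj/eqP; rewrite eqn_leq xmin// ymin.
Qed.

Definition min_mass x : R := \sum_(A : {set 'I_N} | is_min A x) nu A.

(** The renewal inequality: a configuration with leftmost particle [x] is either [[set x]] or has a
    second particle [y], and adding [x] to the left of [y] costs the factor
    [lambda * psi (y - x)]. *)
Lemma min_mass_ge x : lambda + \sum_(y : 'I_N | (x < y)%N) lambda * psi (y - x)%N * min_mass y
  <= min_mass x.
Proof.
rewrite /min_mass [leRHS](bigD1 [set x]%SET)/=; last first.
  by rewrite /is_min !inE eqxx; apply/forall_inP => z; rewrite inE => /eqP ->.
rewrite rev_measure1 lerD2l.
apply: (@le_trans _ _ (\sum_(y : 'I_N | (x < y)%N) \sum_(A | is_min A x &&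
  (A != [set x]%SET) && is_min (A :\ x)%SET y) nu A)); last first.
  rewrite (exchange_big_dep (fun A => is_min A x && (A != [set x]%SET)))/=; last first.
    by move=> y A _ /andP[].
  apply: ler_sum => A /andP[Ax A1]; rewrite Ax A1/=.
  have [/existsP[y /andP[xy Ay]]|noy] :=
      boolP [exists y : 'I_N, (x < y)%N && is_min (A :\ x)%SET y].
    rewrite (big_pred1 y)// => z /=; apply/idP/eqP => [/andP[_ Az]|->]; last by rewrite xy.
    exact: is_min_inj Az Ay.
  (* Without such a [y] the inner sum is empty, and positivity of the weight is enough. *)
  rewrite big1 ?ltW ?(rev_measure_gt0 hpsi lambda_gt0)// => y xy.
  by case/negP: noy; apply/existsP; exists y.
apply: ler_sum => y xy.
rewrite [leRHS](reindex_onto (fun A => x |: A)%SET (fun A => A :\ x)%SET)/=; last first.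
  by move=> A /andP[/andP[Ax _] _]; rewrite finset.setD1K//; case/andP: Ax.
rewrite mulr_sumr le_eqVlt; apply/orP; left; apply/eqP.
apply: eq_big => [A|A /andP[yA /forall_inP ymin]].
  apply/idP/idP => [Ay|/andP[/andP[_ Ay] /eqP AE]]; last by rewrite AE in Ay.
  case/andP: (Ay) => yA /forall_inP ymin.
  have xA : x \notin A by apply/negP => /ymin; lia.
  rewrite setU1K// eqxx andbT Ay andbT; apply/andP; split.
    apply/andP; split; first by rewrite !inE eqxx.
    by apply/forall_inP => z; rewrite !inE => /orP[/eqP ->//|/ymin]; lia.
  apply/eqP => /setP/(_ y); rewrite !inE yA orbT => /esym/eqP yx.
  by move: xy; rewrite yx ltnn.
have xA : x \notin A by apply/negP => /ymin; lia.
rewrite (rev_measure_setU1 hpsi)//; last by apply/set0Pn; exists y.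
congr (_ * _); rewrite /birth ldist_none => [|z /ymin]; last by lia.
by rewrite (@rdist_eq _ A x y)// => z /ymin.
Qed.

(** Iterates the renewal inequality [k] times over gaps of length at most [m]. The condition
    [x + k * m < N] keeps all these gaps inside the interval. *)
Lemma min_mass_growth m k x : 1 < lambda ->
  1 <= lambda * \sum_(1 <= i < m.+1) psi i -> (x + k * m < N)%N ->
  (lambda * \sum_(1 <= i < m.+1) psi i) ^+ k <= min_mass x.
Proof.
move=> lambda1 s1; have psi0 n : (0 < n)%N -> 0 <= psi n by move=> /(nps_gt0 hpsi)/ltW.
have mass0 y : 0 <= min_mass y.
  by apply: sumr_ge0 => A _; rewrite ltW// (rev_measure_gt0 hpsi lambda_gt0).
elim: k x => [|k IH] x xN.
  apply: le_trans (min_mass_ge x); rewrite (le_trans (ltW lambda1))// lerDl.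
  apply: sumr_ge0 => y xy.
  by rewrite !mulr_ge0 ?(ltW lambda_gt0)// psi0//; lia.
apply: le_trans (min_mass_ge x).
rewrite -[leLHS]add0r lerD ?(ltW lambda_gt0)//.
set s := lambda * _ in s1 IH *.
have -> : s ^+ k.+1 = \sum_(y < N | (x < y < x + m.+1)%N) lambda * psi (y - x)%N * s ^+ k.
  rewrite (sum_ord_range N x.+1 (x + m.+1)
    (fun y : nat => lambda * psi (y - x)%N * s ^+ k)); last by lia.
  rewrite -mulr_suml -mulr_sumr exprS; congr (_ * _ * _).
  rewrite -(add1n x) big_addn addKn.
  by apply: eq_bigr => i _; rewrite addnK.
rewrite [leLHS]big_mkcond [leRHS]big_mkcond; apply: ler_sum => y _.
have [xy|xy] /= := ltnP x y; last by [].
have c0 : 0 <= lambda * psi (y - x)%N.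
  by rewrite mulr_ge0 ?(ltW lambda_gt0)// psi0//; lia.
case: ifP => ym; last by rewrite mulr_ge0.
by rewrite ler_wpM2l// IH//; lia.
Qed.

(** The full configuration minimises the extinction probability, so it can replace every [A] in
    [rev_measure_extinction]. The total mass of nonempty configurations is at least the [min_mass]
    of the first site. *)
Lemma extinction_from_full_bound p t m k : 1 < lambda ->
  is_transition_function q p -> 0 <= t ->
  1 <= lambda * \sum_(1 <= i < m.+1) psi i -> (k * m < N)%N ->
  p t [set: 'I_N]%SET finset.set0 <=
    lambda * N%:R * t / (lambda * \sum_(1 <= i < m.+1) psi i) ^+ k.
Proof.
move=> lambda1 hp t0 s1 kmN.
have N0 : (0 < N)%N by lia.
set s := lambda * _ in s1 *.
have sk0 : 0 < s ^+ k by rewrite exprn_gt0// (lt_le_trans ltr01).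
rewrite ler_pdivlMr// mulrC (le_trans _ (rev_measure_extinction p hp t t0))//.
apply: (@le_trans _ _ (\sum_(A | A != finset.set0) nu A * p t [set: 'I_N]%SET finset.set0)).
  rewrite -mulr_suml ler_wpM2r ?(trf_ge0 hp)//.
  apply: (le_trans (min_mass_growth m k (Ordinal N0) lambda1 s1 kmN)).
  rewrite /min_mass [leLHS]big_mkcond [leRHS]big_mkcond; apply: ler_sum => A _.
  case: ifPn => [/andP[A0 _]|_].
    by rewrite ifT//; apply/set0Pn; exists (Ordinal N0).
  by case: ifP => // _; rewrite ltW// (rev_measure_gt0 hpsi lambda_gt0).
apply: ler_sum => A A0; rewrite ler_wpM2l ?(ltW (rev_measure_gt0 hpsi lambda_gt0 _))//.
exact: extinction_from_full_le.
Qed.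

End Supercritical.

(** * Hitting times *)

Section HittingTime.
Context {R : realType} {S : finType} {d : measure_display}
  {Omega : measurableType d} {P : probability Omega R}
  {q : S -> S -> R} {i0 : S} {X : R -> Omega -> S}.
Hypothesis hX : is_markov_chain P q i0 X.
Variable o : S.

Lemma hitting_time_ge0 w : (0 <= hitting_time X o w)%E.
Proof. by apply: le_ereal_inf_tmp => _ [t [t0 _] <-]; rewrite lee_fin. Qed.

Lemma hitting_time_le t w : 0 <= t -> X t w = o -> (hitting_time X o w <= t%:E)%E.
Proof. by move=> t0 Xt; apply: ereal_inf_lbound; exists t. Qed.

(** Indexed by codes of rationals so that countable unions apply; a code of no rational gives the
    empty set. *)
Definition at_rational_before (t : R) (n : nat) : set Omega :=
  if @unpickle rat n is Some r then
    if (0 <= (ratr r : R)) && (ratr r < t) then [set w | X (ratr r) w = o] else set0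
  else set0.

(** By right continuity a path that reaches [o] before [t] stays there for a short while, which
    contains a rational time. *)
Lemma hitting_time_ltE t :
  [set w | (hitting_time X o w < t%:E)%E] = \bigcup_n at_rational_before t n.
Proof.
apply/seteqP; split => w /=.
  move=> /ereal_inf_lt[_ [s [s0 Xs] <-]]; rewrite lte_fin => st.
  have [e /= e0 He] := mc_right_continuous hX w s0.
  have sm : s < Num.min (s + e) t by rewrite lt_min st ltrDl e0.
  have [r] := rat_in_itvoo sm; rewrite in_itv/= lt_min => /andP[sr /andP[re rt]].
  exists (pickle r); first exact: I.
  rewrite /at_rational_before pickleK.
  rewrite (ltW (le_lt_trans s0 sr)) rt/= -Xs; apply: He => //=.
  by rewrite ltr0_norm ?subr_lt0// opprB ltrBlDl.
move=> [n _]; rewrite /at_rational_before; case: (unpickle n) => // r.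
case: ifP => // /andP[r0 rt] /= Xr; apply: (le_lt_trans (hitting_time_le _ _ r0 Xr)).
by rewrite lte_fin.
Qed.

Lemma measurable_at_rational_before t n : measurable (at_rational_before t n).
Proof.
rewrite /at_rational_before; case: (unpickle n) => // r.
by case: ifP => // /andP[r0 _]; exact: (mc_measurable hX).
Qed.

Lemma measurable_hitting_time_lt t : measurable [set w | (hitting_time X o w < t%:E)%E].
Proof.
rewrite hitting_time_ltE; apply: bigcup_measurable => n _.
exact: measurable_at_rational_before.
Qed.

Lemma measurable_hitting_time : measurable_fun setT (hitting_time X o : Omega -> \bar R).
Proof.
apply: (measurability _ (ErealGenInftyO.measurableE R)) => //.
move=> /= _ [_ [x ->] <-]; rewrite setTI preimage_itvNyo.
exact: measurable_hitting_time_lt.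
Qed.

Lemma measurable_hitting_time_le t : measurable [set w | (hitting_time X o w <= t%:E)%E].
Proof.
rewrite -preimage_itvNyc -[X in measurable X]setTI.
by apply: measurable_hitting_time => //; exact: emeasurable_itv.
Qed.

Lemma measurable_hitting_time_ge t : measurable [set w | (t%:E <= hitting_time X o w)%E].
Proof.
rewrite -preimage_itvcy -[X in measurable X]setTI.
by apply: measurable_hitting_time => //; exact: emeasurable_itv.
Qed.

Section TransitionFunction.
Context (p : R -> S -> S -> R) (hp : is_transition_function q p)
  (fdd : forall s : seq (R * S), path <=%R 0 (unzip1 s) ->
        P [set w | forall t i, (t, i) \in s -> X t w = i]
          = (path_prob p 0 i0 s)%:E).

Lemma marginal t i : 0 <= t -> P [set w | X t w = i] = (p t i0 i)%:E.
Proof.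
move=> t0; have := fdd [:: (t, i)]; rewrite /= t0 => /(_ isT).
rewrite subr0 mulr1 => <-; congr (P _); apply/seteqP; split => w /=.
  by move=> Xt s j; rewrite inE => /eqP[-> ->].
by apply; rewrite inE.
Qed.

Hypothesis absorbing : forall t, 0 <= t -> p t o o = 1.

(** As [o] is absorbing for [p], the two-time distribution gives the events [X s = o] and
    [X s = X t = o] the same probability. *)
Lemma null_escape s t : 0 <= s -> s <= t ->
  P [set w | X s w = o /\ X t w <> o] = 0%E.
Proof.
move=> s0 st; have t0 := le_trans s0 st.
have mXs := mc_measurable hX o s0; have mXt := mc_measurable hX o t0.
have -> : [set w | X s w = o /\ X t w <> o] =
    [set w | X s w = o] `\` [set w | X t w = o] by [].
have -> : P ([set w | X s w = o] `\` [set w | X t w = o]) =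
    (P [set w | X s w = o] - P ([set w | X s w = o] `&` [set w | X t w = o]))%E.
  by apply: measureD => //; rewrite -ge0_fin_numE ?fin_num_measure.
have -> : [set w | X s w = o] `&` [set w | X t w = o] =
    [set w | forall u i, (u, i) \in [:: (s, o); (t, o)] -> X u w = i].
  apply/seteqP; split => w /=.
    by move=> [Xs Xt] u i; rewrite !inE => /orP[]/eqP[-> ->].
  by move=> H; split; apply: H; rewrite !inE eqxx ?orbT.
rewrite fdd /= ?s0 ?st// subr0 absorbing ?subr_ge0// !mulr1 marginal//.
by rewrite subee.
Qed.

(** Paths need not be absorbed surely, but those at [o] at a rational time before [t] and away from
    [o] at [t] form a countable union of null sets. *)
Lemma hitting_time_lt_prob t : 0 <= t ->
  (P [set w | (hitting_time X o w < t%:E)%E] <= (p t i0 o)%:E)%E.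
Proof.
move=> t0; have mXt := mc_measurable hX o t0.
pose E n := at_rational_before t n `\` [set w | X t w = o].
have mE n : measurable (E n).
  by apply: measurableD => //; exact: measurable_at_rational_before.
have E0 : P (\bigcup_n E n) = 0%E.
  apply/eqP; rewrite eq_le measure_ge0 andbT.
  apply: (le_trans (generalized_Boole_inequality P mE _)).
    exact: bigcup_measurable.
  rewrite eseries0// => n _ _; rewrite /E /at_rational_before.
  case: (unpickle n) => [r|]; last by rewrite set0D measure0.
  case: ifP => [/andP[r0 rt]|_]; last by rewrite set0D measure0.
  exact: null_escape r0 (ltW rt).
rewrite -marginal// -[leRHS]adde0 -E0.
apply: le_trans (measureU2 _ mXt _); last exact: bigcup_measurable.
apply: le_measure; rewrite ?inE.
- exact: measurable_hitting_time_lt.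
- by apply: measurableU => //; exact: bigcup_measurable.
rewrite hitting_time_ltE => w [n _ An].
by have [Xt|Xt] := pselect (X t w = o); [left|right; exists n].
Qed.

Lemma prob_not_target t : 0 <= t ->
  P [set w | X t w <> o] = (1 - p t i0 o)%:E.
Proof.
move=> t0; have -> : [set w | X t w <> o] = ~` [set w | X t w = o] by [].
transitivity (1 - P [set w | X t w = o])%E; last by rewrite marginal// EFinB.
exact: probability_setC (mc_measurable hX o t0).
Qed.

(** If [n] is the first index with [X (t0 + n) w = o], the first [n] terms equal 1. If there is
    none, the sum is infinite. *)
Lemma hitting_time_le_sum t0 w : 0 <= t0 ->
  (hitting_time X o w <= t0%:E + \sum_(k <oo) (\1_[set w | X (t0 + k%:R) w <> o] w)%:E)%E.
Proof.
move=> t00; set u := fun k : nat => (\1_[set w | X (t0 + k%:R) w <> o] w)%:E : \bar R.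
have u0 k : (0 <= u k)%E by rewrite lee_fin.
have prefix n : (forall k, (k < n)%N -> X (t0 + k%:R) w <> o) ->
    (n%:R%:E <= \sum_(k <oo) u k)%E.
  move=> alive; apply: le_trans (nneseries_lim_ge n _) => //.
  rewrite (eq_big_nat _ _ (F2 := fun=> 1%:E)) => [|k /andP[_ kn]].
    by rewrite sumEFin sumr_const_nat subn0.
  by rewrite /u indicE mem_set//; exact: alive.
have [[n0 dead]|alive] := pselect (exists n : nat, X (t0 + n%:R) w = o).
  have ex : exists n, `[< X (t0 + n%:R) w = o >] by exists n0; apply/asboolP.
  case: (ex_minnP ex) => n /asboolP Xn nmin.
  apply: (le_trans (hitting_time_le _ _ _ Xn)); first by rewrite addr_ge0.
  rewrite EFinD leeD2l//; apply: prefix => k kn Xk.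
  by have := nmin k; rewrite leqNgt kn => /(_ (asboolT Xk)).
rewrite (_ : \sum_(k <oo) u k = +oo)%E ?addey// ?leey//.
apply/eqyP => A A0; have [n An] : exists n : nat, A <= n%:R.
  by exists (Num.bound A); rewrite (ltW (archi_boundP (ltW A0))).
apply: (@le_trans _ _ n%:R%:E); first by rewrite lee_fin.
by apply: prefix => k _ Xk; apply: alive; exists k.
Qed.

(** Integrating [hitting_time_le_sum] term by term leaves a geometric series. *)
Lemma expected_hitting_time_le t0 (a z : R) : 0 <= t0 -> 0 <= z < 1 ->
  (forall k : nat, 1 - p (t0 + k%:R) i0 o <= a * z ^+ k) ->
  (\int[P]_w hitting_time X o w <= (t0 + a / (1 - z))%:E)%E.
Proof.
move=> t00 /andP[z0 z1] tail.
have t0k k : 0 <= t0 + k%:R by rewrite addr_ge0.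
have mD k : measurable [set w | X (t0 + k%:R) w <> o].
  have -> : [set w | X (t0 + k%:R) w <> o] = ~` [set w | X (t0 + k%:R) w = o] by [].
  exact: measurableC (mc_measurable hX o (t0k k)).
have mI k : measurable_fun setT
    (fun w => (\1_[set w | X (t0 + k%:R) w <> o] w)%:E : \bar R).
  by apply/measurable_EFinP; exact: measurable_indic.
have mS : measurable_fun setT (fun w =>
    \sum_(k <oo) (\1_[set w | X (t0 + k%:R) w <> o] w)%:E : \bar R)%E.
  by apply: ge0_emeasurable_sum => // k w _ _; rewrite lee_fin.
apply: (@le_trans _ _ (\int[P]_w (cst t0%:E w +
    \sum_(k <oo) (\1_[set w | X (t0 + k%:R) w <> o] w)%:E))%E).
  apply: ge0_le_integral => //.
  - by move=> w _; exact: hitting_time_ge0.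
  - exact: measurable_hitting_time.
  - exact: emeasurable_funD.
  - by move=> w _; exact: hitting_time_le_sum.
rewrite ge0_integralD//; last by move=> w _; apply: nneseries_ge0 => *; rewrite lee_fin.
rewrite integral_cst// [X in (_ * X)%E](_ : _ = 1%E); last exact: probability_setT.
rewrite mule1 EFinD leeD2l//.
rewrite integral_nneseries//.
apply: lime_le.
  by apply: is_cvg_nneseries => n _ _; apply: integral_ge0 => w _; rewrite lee_fin.
near=> n.
rewrite (eq_bigr (fun k : nat => (1 - p (t0 + k%:R) i0 o)%:E)) => [|k _]; last first.
  by rewrite integral_indic// setIT; exact: prob_not_target.
rewrite sumEFin lee_fin.
apply: (le_trans (ler_sum _ (fun k _ => tail k))).
have a0 : 0 <= a.
  have := tail 0%N; rewrite expr0 mulr1; apply: le_trans.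
  rewrite subr_ge0 -lee_fin -marginal//; exact: probability_le1 (mc_measurable hX o (t0k 0%N)).
have -> : \sum_(0 <= k < n) a * z ^+ k = a * ((1 - z ^+ n) / (1 - z)).
  have := geometric_seriesE a (negbT (lt_eqF z1)) => /(congr1 (fun f => f n)).
  by rewrite /series /= => ->; rewrite mulrA.
rewrite ler_wpM2l// ler_pdivrMr ?subr_gt0// mulVf ?subr_eq0 ?gt_eqF//.
by rewrite gerBl exprn_ge0.
Unshelve. all: by end_near.
Qed.

End TransitionFunction.
End HittingTime.

(** * The two regimes *)

Lemma cvg1_of_inv_bound {R : realType} (u : nat -> \bar R) (K : R) :
  (\forall n \near \oo, ((1 - K / n%:R)%:E <= u n <= 1)%E) -> u n @[n --> \oo] --> 1%E.
Proof.
move=> uK; apply: (squeeze_cvge uK); last exact: cvg_cst.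
apply: cvg_EFin; first by near=> n.
rewrite -[X in _ --> X](subr0 (1 : R)) -[X in _ - X](mulr0 K).
apply: cvgB; first exact: cvg_cst.
apply: cvgMr; apply/gtr0_cvgV0; last exact: cvgr_idn.
by near=> n; rewrite ltr0n; near: n; exact: nbhs_infty_gt.
Unshelve. all: by end_near.
Qed.

Lemma subcritical_rate {R : realType} (psi : nat -> R) (lambda : R) :
  nps_weight psi -> 0 < lambda -> lambda < Num.min 1 (subcritical_bound psi) ->
  exists mu, [/\ lambda <= mu, mu < 1 & forall n, (2 <= n)%N ->
     lambda * \sum_(1 <= l < n) psi l * psi (n - l)%N <= mu * psi n].
Proof.
move=> hpsi lambda0; rewrite lt_min => /andP[lambda1 lambda_sb].
set sb := subcritical_bound psi in lambda_sb.
have sb0 : 0 < sb by exact: lt_trans lambda_sb.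
have psi0 n : (0 < n)%N -> 0 <= psi n by move=> /(nps_gt0 hpsi)/ltW.
have S0 n : 0 <= \sum_(1 <= l < n) psi l * psi (n - l)%N.
  rewrite big_nat_cond; apply: sumr_ge0 => l /andP[/andP[l1 ln] _].
  by rewrite mulr_ge0 ?psi0//; lia.
(* The first entry serves the end gaps, the second the gaps between two particles. *)
exists (Num.max lambda (lambda / sb)); split.
- by rewrite le_max lexx.
- by rewrite gt_max lambda1 ltr_pdivrMr// mul1r.
move=> n n2; have pn : 0 <= psi n by apply: psi0; lia.
apply: (@le_trans _ _ (lambda / sb * psi n)); last first.
  by rewrite ler_wpM2r// le_max lexx orbT.
rewrite -mulrA ler_pM2l// [leRHS]mulrC ler_pdivlMr//.
have := S0 n; rewrite le_eqVlt => /orP[/eqP <-|Sn]; first by rewrite mul0r.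
rewrite mulrC -ler_pdivlMr//; apply: ge_inf; last by exists n.
exists 0 => _ [k /= k2 <-]; rewrite divr_ge0//; apply: psi0; lia.
Qed.

(** Otherwise all partial sums, hence their limit 1, would be at most [1 / lambda < 1]. *)
Lemma supercritical_truncation {R : realType} (psi : nat -> R) (lambda : R) :
  nps_weight psi -> 1 < lambda ->
  exists m, 1 < lambda * \sum_(1 <= i < m.+1) psi i.
Proof.
move=> hpsi lambda1; have lambda0 : 0 < lambda by exact: lt_trans lambda1.
apply: contrapT => /forallNP no.
have : (\sum_(1 <= n <oo) (psi n)%:E <= lambda^-1%:E)%E.
  apply: lime_le.
    by apply: is_cvg_nneseries => n n1 _; rewrite lee_fin ltW// (nps_gt0 hpsi).
  near=> n; rewrite sumEFin lee_fin.
  have n0 : (0 < n)%N by near: n; exact: nbhs_infty_gt.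
  rewrite -(prednK n0) -[leRHS]mul1r ler_pdivlMr// mulrC leNgt; exact/negP.
rewrite (nps_sum1 hpsi) lee_fin invf_ge1// => /(lt_le_trans lambda1).
by rewrite ltxx.
Unshelve. all: by end_near.
Qed.

Section MainTheorem.
Context {R : realType} (psi : nat -> R) (lambda : R)
    (hpsi : nps_weight psi) (hlambda : 0 < lambda)
    (d : nat -> measure_display) (Omega : forall N : nat, measurableType (d N))
    (P : forall N : nat, probability (Omega N) R)
    (X : forall N : nat, R -> Omega N -> {set 'I_N})
    (hX : forall N : nat, (1 <= N)%N -> is_nps_from_full psi lambda (P N) (X N)).

Section SubcriticalTheorem.
Context (mu : R) (mu_lambda : lambda <= mu) (mu_lt1 : mu < 1)
  (mu_conv : forall n, (2 <= n)%N ->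
     lambda * \sum_(1 <= l < n) psi l * psi (n - l)%N <= mu * psi n).

Let rate := (1 - mu) ^+ 2.
Let rate_gt0 : 0 < rate. Proof. by rewrite exprn_gt0// subr_gt0. Qed.
Let K_ge0 : 0 <= (1 - mu)^-1. Proof. by rewrite invr_ge0 subr_ge0 ltW. Qed.

Lemma subcritical_expectation :
  exists C : R, forall N : nat, (2 <= N)%N ->
    (\int[P N]_w extinction_time (X N) w <= (C * ln N%:R)%:E)%E.
Proof.
have z1 : expR (- rate) < 1 by rewrite -[ltRHS]expR0 ltr_expR oppr_lt0.
pose B := (1 - mu)^-1 / (1 - expR (- rate)).
have B0 : 0 <= B by rewrite divr_ge0// subr_ge0 ltW.
have ln2 : 0 < ln (2 : R) by rewrite ln_gt0// ltr1n.
(* At time [ln N / rate] the survival bound has lost its factor [N]; from there on the geometric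
   tail costs at most [B], which [ln 2 <= ln N] absorbs. *)
exists (rate^-1 + B / ln 2) => N N2.
have N0 : (0 < N)%N by lia.
have hN := hX N N0; have [p hp fdd] := mc_fdd hN.
have lnN : 0 <= ln (N%:R : R) by rewrite ln_ge0// ler1n.
have t0 : 0 <= ln N%:R / rate by rewrite divr_ge0// ltW.
apply: (le_trans (@expected_hitting_time_le _ _ _ _ _ _ _ _ hN finset.set0 p fdd
  (ln N%:R / rate) (1 - mu)^-1 (expR (- rate)) t0 _ _)).
- by rewrite expR_ge0 z1.
- move=> k; have tk0 : 0 <= ln N%:R / rate + k%:R by rewrite addr_ge0.
  apply: (le_trans (survival_bound hpsi hlambda mu mu_lambda mu_lt1 mu_conv p _ hp tk0)).
  rewrite -/rate (_ : - (rate * _) = - ln N%:R + k%:R * - rate); last first.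
    by field; rewrite gt_eqF.
  rewrite expRD expRN lnK ?posrE ?ltr0n// expRM_natl mulrA.
  by rewrite [_ / (1 - mu)]mulrC mulfK// pnatr_eq0 -lt0n.
rewrite lee_fin mulrDl [rate^-1 * _]mulrC lerD2l -/B -mulrA ler_peMr//.
by rewrite mulrC ler_pdivlMr// mul1r ler_ln ?posrE ?ltr0n// ler_nat.
Qed.

Lemma subcritical_probability (c : nat -> R) : c N @[N --> \oo] --> +oo ->
  P N [set w | (extinction_time (X N) w <= (c N * ln N%:R)%:E)%E]
    @[N --> \oo] --> 1%E.
Proof.
move=> cy; apply: (@cvg1_of_inv_bound _ _ (1 - mu)^-1); near=> N.
have N0 : (0 < N)%N by near: N; exact: nbhs_infty_gt.
(* Beyond this threshold the exponential factor is at most [N ^- 2], which turns the prefactor [N]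
   into [1 / N]. *)
have cN : 2 / rate <= c N by near: N; move/cvgryPge : cy; exact.
have hN := hX N N0; have [p hp fdd] := mc_fdd hN.
have lnN : 0 <= ln (N%:R : R) by rewrite ln_ge0// ler1n.
have c0 : 0 <= c N by rewrite (le_trans _ cN)// divr_ge0// ltW.
have t0 : 0 <= c N * ln N%:R by rewrite mulr_ge0.
rewrite probability_le1 ?andbT; last exact: measurable_hitting_time_le hN _ _.
apply: (@le_trans _ _ (p (c N * ln N%:R) [set: 'I_N]%SET finset.set0)%:E).
  rewrite lee_fin lerBlDr -lerBlDl.
  apply: (le_trans (survival_bound hpsi hlambda mu mu_lambda mu_lt1 mu_conv p _ hp t0)).
  rewrite -/rate mulrC mulrA mulrC ler_wpM2l//.
  have -> : N%:R^-1 = N%:R * expR (- (2 * ln N%:R)) :> R.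
    rewrite expRN expRM_natl lnK ?posrE ?ltr0n//.
    by field; rewrite pnatr_eq0 -lt0n.
  rewrite mulrC ler_wpM2l// ler_expR lerN2 mulrA ler_wpM2r//.
  by rewrite mulrC -ler_pdivrMr.
rewrite -(marginal p fdd)//; apply: le_measure; rewrite ?inE.
- exact: (mc_measurable hN finset.set0 t0).
- exact: measurable_hitting_time_le hN _ _.
- by move=> w /= Xt; exact: hitting_time_le.
Unshelve. all: by end_near.
Qed.

End SubcriticalTheorem.

Lemma supercritical_probability : 1 < lambda -> exists2 gamma : R, 0 < gamma &
  P N [set w | ((expR (gamma * N%:R))%:E <= extinction_time (X N) w)%E]
    @[N --> \oo] --> 1%E.
Proof.
move=> lambda1; have [m] := supercritical_truncation psi lambda hpsi lambda1.
set s := lambda * _ => s1.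
have m0 : (0 < m)%N.
  by case: m @s s1 => // s; rewrite /s big_geq// mulr0 ltNge ler01.
have lns : 0 < ln s by rewrite ln_gt0.
have s0 : 0 < s by exact: lt_trans s1.
(* Chosen so that [expR (2 * gamma * N)] equals [s] to the power [N / m]: the mass then beats the
   square of the time [t]. *)
pose gamma := ln s / (2 * m%:R).
have gamma0 : 0 < gamma by rewrite divr_gt0// mulr_gt0// ltr0n.
exists gamma => //.
(* The extinction probability is at most [lambda * s * N / t], and [t >= (gamma * N) ^ 2 / 2] makes
   this a constant over [N]. *)
apply: (@cvg1_of_inv_bound _ _ (lambda * s * (2 / gamma ^+ 2))); near=> N.
have N0 : (0 < N)%N by near: N; exact: nbhs_infty_gt.
have hN := hX N N0; have [p hp fdd] := mc_fdd hN.
set t := expR (gamma * N%:R); have t0 : 0 <= t by exact: expR_ge0.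
have mge := measurable_hitting_time_ge hN finset.set0 t.
rewrite probability_le1// andbT.
have -> : P N [set w | (t%:E <= extinction_time (X N) w)%E] =
    (1 - P N [set w | (extinction_time (X N) w < t%:E)%E])%E.
  rewrite -probability_setC; last exact: measurable_hitting_time_lt hN _ _.
  by congr (P N _); apply/seteqP; split => w /=; rewrite leNgt => /negP.
rewrite EFinB leeB//.
apply: (le_trans (@hitting_time_lt_prob _ _ _ _ _ _ _ _ hN finset.set0 p fdd
  (set0_absorbing hpsi hlambda p hp) t t0)).
(* The largest [k] with [k * m < N]; maximality gives [N <= k.+1 * m], and the surplus factor [s]
   goes into the constant. *)
pose k := (N.-1 %/ m)%N.
have kmN : (k * m < N)%N by have := leq_trunc_div N.-1 m; lia.
have NkM : (N <= k.+1 * m)%N by have := ltn_ceil N.-1 m0; lia.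
rewrite lee_fin.
apply: (le_trans (extinction_from_full_bound hpsi hlambda p t m k lambda1 hp t0 (ltW s1) kmN)).
rewrite -/s.
have sk : expR (2 * (gamma * N%:R)) <= s ^+ k.+1.
  rewrite -[s in leRHS](lnK (x := s)) ?posrE// -expRM_natl ler_expR.
  rewrite /gamma (_ : 2 * (_ * N%:R) = N%:R / m%:R * ln s); last first.
    by field; rewrite pnatr_eq0 -lt0n.
  by rewrite ler_wpM2r ?(ltW lns)// ler_pdivrMr ?ltr0n// -natrM ler_nat.
have sk0 : 0 < s ^+ k by rewrite exprn_gt0.
have N0' : 0 < N%:R :> R by rewrite ltr0n.
rewrite ler_pdivrMr//.
have tt : t ^+ 2 <= s * s ^+ k by rewrite -exprS /t -expRM_natl.
(* Only the quadratic term of the exponential is kept. *)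
have tN : (gamma * N%:R) ^+ 2 / 2 <= t.
  have := @expR_ge1Dxn _ (gamma * N%:R) 1 (ltW (mulr_gt0 gamma0 N0')).
  by rewrite factE/=; apply: le_trans; rewrite lerDr.
have N2 : N%:R ^+ 2 <= 2 / gamma ^+ 2 * t.
  by rewrite mulrAC ler_pdivlMr ?exprn_gt0// -exprMn [_ * gamma]mulrC [2 * t]mulrC -ler_pdivrMr.
have -> : lambda * s * (2 / gamma ^+ 2) / N%:R * s ^+ k =
    lambda * (2 / gamma ^+ 2) / N%:R * (s * s ^+ k) by ring.
apply: (@le_trans _ _ (lambda * (2 / gamma ^+ 2) / N%:R * t ^+ 2)); last first.
  by rewrite ler_wpM2l// !mulr_ge0 ?invr_ge0 ?exprn_ge0 ?(ltW hlambda) ?(ltW gamma0).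
have -> : lambda * N%:R * t = lambda / N%:R * t * N%:R ^+ 2.
  by field; rewrite pnatr_eq0 -lt0n.
have -> : lambda * (2 / gamma ^+ 2) / N%:R * t ^+ 2 =
    lambda / N%:R * t * (2 / gamma ^+ 2 * t) by ring.
by rewrite ler_wpM2l// !mulr_ge0 ?invr_ge0 ?(ltW hlambda).
Unshelve. all: by end_near.
Qed.


End MainTheorem.

Theorem theorem1p2 (R : realType) (psi : nat -> R) (lambda : R)
    (hpsi : nps_weight psi) (hlambda : 0 < lambda)
    (d : nat -> measure_display) (Omega : forall N : nat, measurableType (d N))
    (P : forall N : nat, probability (Omega N) R)
    (X : forall N : nat, R -> Omega N -> {set 'I_N})
    (hX : forall N : nat, (1 <= N)%N -> is_nps_from_full psi lambda (P N) (X N)) :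
  (lambda < Num.min 1 (subcritical_bound psi) ->
    (exists C : R, forall N : nat, (2 <= N)%N ->
       (\int[P N]_w extinction_time (X N) w <= (C * ln N%:R)%:E)%E)
    /\
    (forall c : nat -> R,
       (forall M N : nat, (1 <= M)%N -> (M <= N)%N -> c M <= c N) ->
       c N @[N --> \oo] --> +oo ->
       P N [set w | (extinction_time (X N) w <= (c N * ln N%:R)%:E)%E]
         @[N --> \oo] --> 1%E))
  /\
  (1 < lambda ->
    exists2 gamma : R, 0 < gamma &
      P N [set w | ((expR (gamma * N%:R))%:E <= extinction_time (X N) w)%E]
        @[N --> \oo] --> 1%E).
Proof.
split => [lambda_lt|lambda1]; last first.
  exact: (@supercritical_probability _ _ _ hpsi hlambda _ _ _ _ hX lambda1).
have [mu [mu_lambda mu_lt1 mu_conv]] := subcritical_rate psi lambda hpsi hlambda lambda_lt.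
split; first exact: (@subcritical_expectation _ _ _ hpsi hlambda _ _ _ _ hX mu).
by move=> c _; exact: (@subcritical_probability _ _ _ hpsi hlambda _ _ _ _ hX mu).
Qed.
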